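(* Let $A$ be a Banach algebra, and let $X$ be a left Banach $A$-module. Then the following conditions are equivalent: (i) for every exact sequence $0\to Y_1\to Y_2\to Y_3\to0$ of right Fréchet $A$-modules and continuous module maps that splits as a sequence of Fréchet spaces, the sequence $0\to Y_1\mathbin{\widehat\otimes}_A X\to Y_2\mathbin{\widehat\otimes}_A X\to Y_3\mathbin{\widehat\otimes}_A X\to0$ is exact in the category of vector spaces (i.e. $X$ is flat as a Fréchet $A$-module); (ii) for every exact sequence $0\to Y_1\to Y_2\to Y_3\to0$ of right Banach $A$-modules and continuous module maps that splits as a sequence of Banach spaces, the sequence $0\to Y_1\mathbin{\widehat\otimes}_A X\to Y_2\mathbin{\widehat\otimes}_A X\to Y_3\mathbin{\widehat\otimes}_A X\to0$ is exact in the category of vector spaces (i.e. $X$ is flat as a Banach $A$-module).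
   Context: All spaces are over $\mathbb C$. A (left or right) Fréchet (Banach) $A$-module is a Fréchet (Banach) space with a jointly continuous $A$-module structure. ''Splits'' means split exact by continuous linear maps (not necessarily module maps). $\widehat\otimes$ is the completed projective tensor product; for a right module $Y$ and a left module $X$, $Y\mathbin{\widehat\otimes}_A X=(Y\mathbin{\widehat\otimes}X)/N$, where $N$ is the closed linear span of all $y\cdot a\otimes x-y\otimes a\cdot x$ ($y\in Y$, $x\in X$, $a\in A$). *)

(* Defs.v *)
From HB Require Import structures.
From mathcomp Require Import all_boot all_order all_algebra.
From mathcomp Require Import generic_quotient complex freeg.
From mathcomp Require Import all_classical all_reals interval_inference convex.
From mathcomp Require Import topology normedtype.

Set Implicit Arguments.
Unset Strict Implicit.
Unset Printing Implicit Defensive.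

Import Order.TTheory GRing.Theory Num.Theory.

Local Open Scope classical_set_scope.
Local Open Scope quotient_scope.
Local Open Scope ring_scope.

(* [submodClosed] is only declared closed under addition and scaling. *)
Lemma submodN (K : nzRingType) (V : lmodType K) (N : submodClosed V) x :
  (- x \in N) = (x \in N).
Proof.
have h y : y \in N -> - y \in N by move=> ?; rewrite -scaleN1r rpredZ.
by apply/idP/idP => [/h|/h//]; rewrite opprK.
Qed.

Section LmodQuotient.
Context (K : nzRingType) (V : lmodType K) (N : submodClosed V).

Definition lquot_rel : rel V := fun x y => x - y \in N.

Lemma lquot_rel_refl : reflexive lquot_rel.
Proof. by move=> x; rewrite /lquot_rel subrr rpred0. Qed.

Lemma lquot_rel_sym : symmetric lquot_rel.
Proof. by move=> x y; rewrite /lquot_rel -opprB submodN. Qed.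

Lemma lquot_rel_trans : transitive lquot_rel.
Proof.
move=> y x z xy yz; rewrite /lquot_rel.
by have := rpredD xy yz; rewrite addrA subrK.
Qed.

Definition lquot_equiv := EquivRel lquot_rel
  lquot_rel_refl lquot_rel_sym lquot_rel_trans.
Canonical lquot_equiv.

Definition lquot_type := {eq_quot lquot_equiv}.

HB.instance Definition _ : EqQuotient V lquot_equiv lquot_type := EqQuotient.on lquot_type.
HB.instance Definition _ := Choice.on lquot_type.

Definition lquot_class (x : V) : lquot_type := \pi_lquot_type x.

Lemma lquot_classP x y : lquot_class x = lquot_class y <-> x - y \in N.
Proof. by split=> [/eqP|h]; [|apply/eqP]; rewrite eqmodE. Qed.

Lemma lquot_classK c : lquot_class (repr c) = c.
Proof. exact: reprK. Qed.

Lemma lquot_class_repr x : x - repr (lquot_class x) \in N.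
Proof. by apply/lquot_classP; rewrite lquot_classK. Qed.

Definition lquot_zero : lquot_type := lquot_class 0.
Definition lquot_opp (c : lquot_type) : lquot_type := lquot_class (- repr c).
Definition lquot_add (c d : lquot_type) : lquot_type := lquot_class (repr c + repr d).
Definition lquot_scale (a : K) (c : lquot_type) : lquot_type := lquot_class (a *: repr c).

Lemma lquot_oppE x : lquot_opp (lquot_class x) = lquot_class (- x).
Proof. by apply/lquot_classP; rewrite opprK addrC lquot_class_repr. Qed.

Lemma lquot_addE x y : lquot_add (lquot_class x) (lquot_class y) = lquot_class (x + y).
Proof.
apply/esym/lquot_classP; rewrite opprD addrACA.
by apply: rpredD; exact: lquot_class_repr.
Qed.

Lemma lquot_scaleE a x : lquot_scale a (lquot_class x) = lquot_class (a *: x).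
Proof.
by apply/esym/lquot_classP; rewrite -scalerBr; apply: rpredZ; exact: lquot_class_repr.
Qed.

Lemma lquot_class_ind (P : lquot_type -> Prop) : (forall x, P (lquot_class x)) -> forall c, P c.
Proof. by move=> h c; rewrite -(lquot_classK c). Qed.

Fact lquot_addA : associative lquot_add.
Proof.
elim/lquot_class_ind=> x; elim/lquot_class_ind=> y; elim/lquot_class_ind=> z.
by rewrite !lquot_addE addrA.
Qed.

Fact lquot_addC : commutative lquot_add.
Proof.
by elim/lquot_class_ind=> x; elim/lquot_class_ind=> y; rewrite !lquot_addE addrC.
Qed.

Fact lquot_add0 : left_id lquot_zero lquot_add.
Proof. by elim/lquot_class_ind=> x; rewrite lquot_addE add0r. Qed.

Fact lquot_addN : left_inverse lquot_zero lquot_opp lquot_add.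
Proof. by elim/lquot_class_ind=> x; rewrite lquot_oppE lquot_addE addNr. Qed.

HB.instance Definition _ := GRing.isZmodule.Build lquot_type
  lquot_addA lquot_addC lquot_add0 lquot_addN.

Fact lquot_scaleA a b c : lquot_scale a (lquot_scale b c) = lquot_scale (a * b) c.
Proof. by elim/lquot_class_ind: c => x; rewrite !lquot_scaleE scalerA. Qed.

Fact lquot_scale1 : left_id 1 lquot_scale.
Proof. by elim/lquot_class_ind=> x; rewrite lquot_scaleE scale1r. Qed.

Fact lquot_scaleDr : right_distributive lquot_scale +%R.
Proof.
move=> a; elim/lquot_class_ind=> x; elim/lquot_class_ind=> y.
by rewrite [_ + _ in LHS]lquot_addE !lquot_scaleE [RHS]lquot_addE scalerDr.
Qed.

Fact lquot_scaleDl c : {morph lquot_scale^~ c : a b / a + b}.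
Proof.
move=> a b; elim/lquot_class_ind: c => x.
by rewrite !lquot_scaleE [RHS]lquot_addE scalerDl.
Qed.

HB.instance Definition _ := GRing.Zmodule_isLmodule.Build K lquot_type
  lquot_scaleA lquot_scale1 lquot_scaleDr lquot_scaleDl.

Definition lquot : lmodType K := lquot_type.

Definition lquot_pi (x : V) : lquot := lquot_class x.

Definition lquot_repr (c : lquot) : V := repr (c : lquot_type).

Fact lquot_pi_linear : linear lquot_pi.
Proof.
move=> a x y; rewrite [_ *: _ in RHS]lquot_scaleE.
by rewrite [RHS]lquot_addE.
Qed.

HB.instance Definition _ :=
  GRing.isLinear.Build K V lquot *:%R lquot_pi lquot_pi_linear.

Lemma lquot_piP x y : lquot_pi x = lquot_pi y <-> x - y \in N.
Proof. exact: lquot_classP. Qed.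

Lemma lquot_reprK c : lquot_pi (lquot_repr c) = c.
Proof. exact: lquot_classK. Qed.

Lemma lquot_reprP x : x - lquot_repr (lquot_pi x) \in N.
Proof. exact: lquot_class_repr. Qed.

Lemma lquot_ind (P : lquot -> Prop) : (forall x, P (lquot_pi x)) -> forall c, P c.
Proof. exact: lquot_class_ind. Qed.

End LmodQuotient.

Section LmodQuotientMap.
Context (K : nzRingType) (V W : lmodType K).
Context (N : submodClosed V) (M : submodClosed W).
Context (f : {linear V -> W}) (fNM : forall x, x \in N -> f x \in M).

Definition lquot_map (c : lquot N) : lquot M := lquot_pi M (f (lquot_repr c)).

Lemma lquot_mapE x : lquot_map (lquot_pi N x) = lquot_pi M (f x).
Proof.
by apply/esym/lquot_piP; rewrite -linearB; apply: fNM; exact: lquot_reprP.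
Qed.

Fact lquot_map_linear : linear lquot_map.
Proof.
move=> a; elim/lquot_ind=> x; elim/lquot_ind=> y.
by rewrite -linearP !lquot_mapE -linearP -linearP.
Qed.

End LmodQuotientMap.

(* A base at 0 of a (not necessarily Hausdorff) locally convex topology,
   consisting of absolutely convex absorbing sets. *)
Record lcBase (K : numFieldType) (V : lmodType K) := LcBase {
  lc_sets :> set V -> Prop;
  lc_ex : exists U, lc_sets U;
  lc_setI : forall U W, lc_sets U -> lc_sets W ->
    exists2 Z, lc_sets Z & Z `<=` U `&` W;
  lc_absconvex : forall U x y (a b : K), lc_sets U -> U x -> U y ->
    `|a| + `|b| <= 1 -> U (a *: x + b *: y);
  lc_absorbing : forall U x, lc_sets U -> exists2 e : K, e != 0 & U (e *: x);
  lc_homothety : forall U (a : K), lc_sets U ->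
    exists2 W, lc_sets W & forall x, W x -> U (a *: x)
}.

Definition lctype_type (K : numFieldType) (V : lmodType K) (b : lcBase V) : Type :=
  V.

Section LcBaseTheory.
Context (K : numFieldType) (V : lmodType K) (b : lcBase V).
Implicit Types (U W : set V) (x y : V) (a : K).

Lemma lc_balanced U x a : b U -> U x -> `|a| <= 1 -> U (a *: x).
Proof.
move=> bU Ux a1; have := @lc_absconvex _ _ b U x x a 0 bU Ux Ux.
by rewrite scale0r addr0 normr0 addr0; apply.
Qed.

Lemma lc_set0 U : b U -> U 0.
Proof.
move=> bU; have [e _ Ue] := lc_absorbing 0 bU.
by move: Ue; rewrite scaler0.
Qed.

Lemma lc_half U : b U -> exists2 W, b W & forall x y, W x -> W y -> U (x + y).
Proof.
move=> bU; have [W bW WU] := lc_homothety 2 bU.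
exists W => // x y Wx Wy.
have -> : x + y = (2^-1 : K) *: ((2 : K) *: x) + (2^-1 : K) *: ((2 : K) *: y).
  by rewrite !scalerA mulVf ?pnatr_eq0// !scale1r.
apply: (lc_absconvex bU); [exact: WU|exact: WU|].
by rewrite ger0_norm ?invr_ge0 ?ler0n// [leRHS]splitr mul1r.
Qed.

Lemma lc_lin U a : b U ->
  exists2 W, b W & forall x y, W x -> W y -> U (a *: x + y).
Proof.
move=> bU; have [W1 bW1 W1U] := lc_half bU.
have [W2 bW2 W2W1] := lc_homothety a bW1.
have [W bW WW] := lc_setI bW1 bW2.
by exists W => // x y /WW[_ /W2W1 ?] /WW[? _]; exact: W1U.
Qed.

Local Notation E := (lctype_type b).

HB.instance Definition _ := GRing.Lmodule.copy E V.

Definition lc_nbhs (x : E) : set_system E :=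
  [set P | exists2 U, b U & forall y, U (y - x) -> P y].

HB.instance Definition _ := hasNbhs.Build E lc_nbhs.

Fact lc_nbhs_filter x : ProperFilter (lc_nbhs x).
Proof.
split.
  by case=> U bU /(_ x); rewrite subrr; apply; exact: lc_set0.
split.
- by have [U bU] := lc_ex b; exists U.
- move=> P Q [U bU UP] [W bW WQ]; have [Z bZ ZUW] := lc_setI bU bW.
  by exists Z => // y /ZUW[Uy Wy]; split; [exact: UP|exact: WQ].
- by move=> P Q PQ [U bU UP]; exists U => // y /UP /PQ.
Qed.

Fact lc_nbhs_singleton x (P : set E) : lc_nbhs x P -> P x.
Proof. by case=> U bU; apply; rewrite subrr; exact: lc_set0. Qed.

Fact lc_nbhs_nbhs x (P : set E) : lc_nbhs x P -> lc_nbhs x (lc_nbhs^~ P).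
Proof.
move=> [U bU UP]; have [W bW WU] := lc_half bU.
exists W => // y Wy; exists W => // z Wz; apply: UP.
by have := WU _ _ Wz Wy; rewrite addrA subrK.
Qed.

HB.instance Definition _ := Nbhs_isNbhsTopological.Build E
  lc_nbhs_filter lc_nbhs_singleton lc_nbhs_nbhs.

Fact lc_add_continuous : continuous (fun x : E * E => x.1 + x.2).
Proof.
move=> [x y] P [U bU UP] /=; have [W bW WU] := lc_half bU.
exists ([set z | W (z - x)], [set z | W (z - y)]).
  by split; exists W.
move=> [z t] /= [Wz Wt]; apply: UP => /=.
by rewrite opprD addrACA; exact: WU.
Qed.

Fact lc_scale_continuous : continuous (fun z : K^o * E => z.1 *: z.2).
Proof.
move=> [r x] P [U bU UP] /=; have [W bW WU] := lc_lin 1 bU.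
have [e e0 We] := lc_absorbing (x : V) bW.
have [W' bW' W'W] := @lc_homothety _ V b W (`|r| + `|e|) bW.
exists ([set l | `|l - r| < `|e|], [set z | W' (z - x)]).
  split; last by exists W'.
  exists `|e|; first by rewrite /= normr_gt0.
  by move=> l /=; rewrite distrC.
move=> [l z] /= [ler Wz]; apply: UP => /=.
have -> : l *: z - r *: x = 1 *: (l *: (z - x)) + (l - r) *: x.
  by rewrite scale1r scalerBr scalerBl addrA subrK.
have re0 : `|r| + `|e| != 0.
  by rewrite gt_eqF// ltr_wpDl// normr_gt0.
apply: WU.
- have -> : l *: (z - x) = (l / (`|r| + `|e|)) *: ((`|r| + `|e|) *: (z - x)).
    by rewrite scalerA mulfVK.
  apply: lc_balanced => //; first exact: W'W.
  rewrite normrM normfV (ger0_norm (_ : 0 <= `|r| + `|e|)) ?addr_ge0//.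
  rewrite ler_pdivrMr ?mul1r ?lt0r ?re0 ?addr_ge0//.
  rewrite -[l](subrK r) addrC (le_trans (ler_normD _ _))// lerD2l ltW//.
- have -> : (l - r) *: x = ((l - r) / e) *: (e *: x) by rewrite scalerA mulfVK.
  apply: lc_balanced => //.
  by rewrite normrM normfV ler_pdivrMr ?mul1r ?normr_gt0// ltW.
Qed.

Fact lc_locally_convex :
  exists2 B : set_system E, (forall U, U \in B -> convex_set U) & basis B.
Proof.
exists [set P | open P /\ convex_set P].
  by move=> P; rewrite inE => -[].
split; first by move=> P [].
move=> x P /= [U bU UP].
exists [set y | exists2 W, b W & forall z, W (z - y) -> U (z - x)].
  split; last by exists U.
  split.
    rewrite openE => y [W bW WU]; have [Z bZ ZW] := lc_half bW.
    exists Z => // z Zz; exists Z => // t Zt; apply: WU.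
    by have := ZW _ _ Zt Zz; rewrite addrA subrK.
  move=> y1 y2 l /[!inE] -[W1 bW1 W1U] -[W2 bW2 W2U].
  have [W bW W12] := lc_setI bW1 bW2; exists W => // z Wz.
  set w := z - _ in Wz; have [W1w W2w] := W12 _ Wz.
  have -> : z - x = l%:num *: (w + y1 - x) + (1 - l%:num) *: (w + y2 - x).
    have e (c : K) y : c *: (w + y - x) = c *: (w - x) + c *: y.
      by rewrite -scalerDr addrAC.
    rewrite !e addrACA -scalerDl [l%:num + _]addrC subrK scale1r.
    by rewrite addrAC; congr (_ - _); rewrite /w subrK.
  apply: (lc_absconvex bU).
  - by apply: W1U; rewrite addrK.
  - by apply: W2U; rewrite addrK.
  - have l0 : 0 <= l%:num :> K by [].
    have l1 : l%:num <= 1 :> K by [].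
    by rewrite !ger0_norm ?subr_ge0// addrC subrK.
move=> y [W bW WU]; apply: UP; apply: WU; rewrite subrr; exact: lc_set0.
Qed.

(* This factory provides the uniform structure only. *)
HB.instance Definition _ := PreTopologicalLmod_isTvs.Build K E
  lc_add_continuous lc_scale_continuous lc_locally_convex.
HB.instance Definition _ :=
  PreTopologicalNmodule_isTopologicalNmodule.Build E lc_add_continuous.
HB.instance Definition _ :=
  TopologicalNmodule_isTopologicalLmodule.Build K E lc_scale_continuous.
HB.instance Definition _ := Uniform_isTvs.Build K E lc_locally_convex.

Definition lctype : tvsType K := E.

Lemma lc_nbhsE (x : lctype) : nbhs x = lc_nbhs x.
Proof. by []. Qed.

End LcBaseTheory.

Section LcContinuity.
Context (K : numFieldType) (V W : lmodType K) (b : lcBase V) (c : lcBase W).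

Definition lc_cont (f : V -> W) :=
  forall U, c U -> exists2 Z, b Z & forall x, Z x -> U (f x).

Lemma lc_contP (f : {linear V -> W}) :
  lc_cont f <-> continuous (f : lctype b -> lctype c).
Proof.
split=> [fc x P [U cU UP]|fc U cU].
  have [Z bZ ZU] := fc _ cU; exists Z => // y Zy; apply: UP.
  by rewrite -linearB; exact: ZU.
have /fc [Z bZ ZU] : nbhs (f 0 : lctype c) U.
  by exists U => // y; rewrite linear0 subr0.
by exists Z => // x Zx; apply: ZU; rewrite subr0.
Qed.

End LcContinuity.

(* Completion by classes of Cauchy sequences modulo null sequences. This is the
   completion of [lctype b] only when the latter is pseudometrizable; completed
   projective tensor products of Frechet spaces are of this kind. *)
Section Completion.
Context (K : numFieldType) (V : lmodType K) (b : lcBase V).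

Definition cauchy_seq : {pred nat -> V} := fun u =>
  `[< forall U, b U ->
      exists n0, forall m n, (n0 <= m)%N -> (n0 <= n)%N -> U (u m - u n) >].

Fact cauchy_seq_submod : submod_closed cauchy_seq.
Proof.
split.
  apply/asboolP => U bU; exists 0%N => m n _ _.
  by rewrite subrr; exact: lc_set0 bU.
move=> a u v /asboolP cu /asboolP cv; apply/asboolP => U bU.
have [W bW WU] := lc_lin a bU.
have [n1 un] := cu W bW; have [n2 vn] := cv W bW.
exists (maxn n1 n2) => m n; rewrite !geq_max => /andP[? ?] /andP[? ?].
have -> : (a *: u + v) m - (a *: u + v) n = a *: (u m - u n) + (v m - v n).
  by rewrite scalerBr opprD addrACA.
by apply: WU; [exact: un|exact: vn].
Qed.

HB.instance Definition _ :=
  GRing.isSubmodClosed.Build K (nat -> V) cauchy_seq cauchy_seq_submod.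

Record cseq := CSeq { cseq_fun :> nat -> V; _ : cseq_fun \in cauchy_seq }.

HB.instance Definition _ := [isSub for cseq_fun].
HB.instance Definition _ := [Choice of cseq by <:].
HB.instance Definition _ := [SubChoice_isSubLmodule of cseq by <:].

Lemma cseqP (u : cseq) U : b U ->
  exists n0, forall m n, (n0 <= m)%N -> (n0 <= n)%N -> U (u m - u n).
Proof. by case: u => u /= /asboolP uc; exact: uc. Qed.

Definition null_seq : {pred cseq} := fun u =>
  `[< forall U, b U -> exists n0, forall n, (n0 <= n)%N -> U (u n) >].

Lemma cseqD (u v : cseq) n : (u + v) n = u n + v n.
Proof. by []. Qed.

Lemma cseqZ a (u : cseq) n : (a *: u) n = a *: u n.
Proof. by []. Qed.

Lemma cseqB (u v : cseq) n : (u - v) n = u n - v n.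
Proof. by []. Qed.

Fact null_seq_submod : submod_closed null_seq.
Proof.
split.
  by apply/asboolP => U bU; exists 0%N => n _; exact: lc_set0 bU.
move=> a u v /asboolP nu /asboolP nv; apply/asboolP => U bU.
have [W bW WU] := lc_lin a bU.
have [n1 un] := nu W bW; have [n2 vn] := nv W bW.
exists (maxn n1 n2) => n; rewrite geq_max => /andP[? ?].
by rewrite cseqD cseqZ; apply: WU; [exact: un|exact: vn].
Qed.

HB.instance Definition _ :=
  GRing.isSubmodClosed.Build K cseq null_seq null_seq_submod.

Definition completion : lmodType K := lquot null_seq.

Fact cst_cauchy (x : V) : (fun=> x) \in cauchy_seq.
Proof.
apply/asboolP => U bU; exists 0%N => m n _ _.
by rewrite subrr; exact: lc_set0 bU.
Qed.

Definition to_completion (x : V) : completion :=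
  lquot_pi null_seq (CSeq (cst_cauchy x)).

Fact to_completion_linear : linear to_completion.
Proof.
move=> a x y; rewrite -[RHS]linearP; congr lquot_pi.
by apply/val_inj/funext => n.
Qed.

HB.instance Definition _ :=
  GRing.isLinear.Build K V completion *:%R to_completion to_completion_linear.

(* For [U] in [b], these sets form a base at 0 of the topology of the
   completion. *)
Definition completion_set (U : set V) : set completion :=
  [set c | exists2 u : cseq, forall n, U (u n) & c = lquot_pi null_seq u].

Definition completion_sets (S : set completion) : Prop :=
  exists2 U, b U & S = completion_set U.

Fact completion_ex : exists S, completion_sets S.
Proof. by have [U bU] := lc_ex b; exists (completion_set U), U. Qed.

Fact completion_setI S T : completion_sets S -> completion_sets T ->
  exists2 Z, completion_sets Z & Z `<=` S `&` T.
Proof.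
move=> [U bU ->] [W bW ->]; have [Z bZ ZUW] := lc_setI bU bW.
exists (completion_set Z); first by exists Z.
by move=> c [u Zu ->]; split; exists u => // n; have [] := ZUW _ (Zu n).
Qed.

Fact completion_absconvex S x y (a a' : K) : completion_sets S -> S x -> S y ->
  `|a| + `|a'| <= 1 -> S (a *: x + a' *: y).
Proof.
move=> [U bU ->] [u Uu ->] [v Uv ->] aa'; exists (a *: u + a' *: v).
  by move=> n; exact: (lc_absconvex bU).
by rewrite linearD !linearZ.
Qed.

Fact completion_absorbing S x : completion_sets S ->
  exists2 e : K, e != 0 & S (e *: x).
Proof.
move=> [U bU ->]; elim/lquot_ind: x => u.
have [W bW WU] := lc_half bU.
have [n0 un] := cseqP u bW.
have [e e0 We] := lc_absorbing (u n0) bW.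
pose e' := e / (1 + `|e|).
have d0 : 0 < 1 + `|e| by rewrite ltr_wpDr.
have e'0 : e' != 0 by rewrite mulf_neq0// invr_eq0 gt_eqF.
have e'1 : `|e'| <= 1.
  rewrite normrM normfV (gtr0_norm d0) ler_pdivrMr// mul1r.
  by rewrite lerDr.
have cv : (fun n => e' *: u (maxn n0 n)) \in cauchy_seq.
  apply/asboolP => Z bZ; have [Z' bZ' ZZ'] := lc_homothety e' bZ.
  have [n1 un1] := cseqP u bZ'; exists n1 => m n m1 n1'.
  by rewrite -scalerBr; apply/ZZ'/un1; rewrite leq_max ?m1 ?n1' orbT.
exists e' => //; exists (CSeq cv) => [n /=|].
  have -> : e' *: u (maxn n0 n) = e' *: (u (maxn n0 n) - u n0) + e' *: u n0.
    by rewrite -scalerDr subrK.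
  apply: WU.
    by apply: (lc_balanced bW) => //; apply: un => //; rewrite leq_maxl.
  rewrite /e' mulrC -scalerA; apply: (lc_balanced bW) => //.
  by rewrite normfV (gtr0_norm d0) invf_le1// lerDl.
rewrite -linearZ; apply/lquot_piP/asboolP => Z bZ.
exists n0 => n n0n; rewrite cseqB cseqZ /= (maxn_idPr n0n) subrr.
exact: lc_set0 bZ.
Qed.

Fact completion_homothety S (a : K) : completion_sets S ->
  exists2 T, completion_sets T & forall x, T x -> S (a *: x).
Proof.
move=> [U bU ->]; have [W bW WU] := lc_homothety a bU.
exists (completion_set W); first by exists W.
move=> _ [u Wu ->]; exists (a *: u); first by move=> n; exact: WU.
by rewrite linearZ.
Qed.

Definition completion_base : lcBase completion := LcBase
  completion_ex completion_setI completion_absconvex completion_absorbing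
  completion_homothety.

End Completion.

Section CompletionMap.
Context (K : numFieldType) (V W : lmodType K) (b : lcBase V) (c : lcBase W).
Context (f : {linear V -> W}) (fc : lc_cont b c f).

Fact cseq_map_subproof (u : cseq b) : f \o u \in cauchy_seq c.
Proof.
apply/asboolP => U cU; have [Z bZ ZU] := fc cU.
have [n0 un] := cseqP u bZ; exists n0 => m n ? ? /=.
by rewrite -linearB; apply/ZU/un.
Qed.

Definition cseq_map (u : cseq b) : cseq c := CSeq (cseq_map_subproof u).

Fact cseq_map_linear : linear cseq_map.
Proof. by move=> a u v; apply/val_inj/funext => n /=; rewrite linearP. Qed.

HB.instance Definition _ :=
  GRing.isLinear.Build K (cseq b) (cseq c) *:%R cseq_map cseq_map_linear.

Fact cseq_map_null (u : cseq b) : u \in @null_seq K V b -> 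
  cseq_map u \in @null_seq K W c.
Proof.
move=> /asboolP nu; apply/asboolP => U cU; have [Z bZ ZU] := fc cU.
by have [n0 un] := nu _ bZ; exists n0 => n ?; apply/ZU/un.
Qed.

Definition completion_map : completion b -> completion c :=
  lquot_map (@null_seq K W c) cseq_map.

Fact completion_map_linear : linear completion_map.
Proof. exact: lquot_map_linear cseq_map_null. Qed.

HB.instance Definition _ := GRing.isLinear.Build K (completion b) (completion c)
  *:%R completion_map completion_map_linear.

Lemma completion_map_to x :
  completion_map (to_completion b x) = to_completion c (f x).
Proof.
rewrite [LHS](lquot_mapE cseq_map_null); congr lquot_pi.
exact/val_inj/funext.
Qed.

Lemma completion_map_cont :
  lc_cont (completion_base b) (completion_base c) completion_map.
Proof.
move=> _ [U cU ->]; have [Z bZ ZU] := fc cU.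
exists (completion_set Z); first by exists Z.
move=> _ [u Zu ->]; exists (cseq_map u); first by move=> n; exact: ZU.
exact: lquot_mapE cseq_map_null _.
Qed.

End CompletionMap.

Section Span.
Context (K : nzRingType) (V : lmodType K).

Definition lspan (S : set V) : {pred V} := fun x =>
  `[< forall N : submodClosed V, (forall s, S s -> s \in N) -> x \in N >].

Fact lspan_submod S : submod_closed (lspan S).
Proof.
split; first by apply/asboolP => N _; exact: rpred0.
move=> a x y /asboolP Sx /asboolP Sy; apply/asboolP => N SN.
by rewrite rpredD ?rpredZ//; [exact: Sx|exact: Sy].
Qed.

HB.instance Definition _ S :=
  GRing.isSubmodClosed.Build K V (lspan S) (lspan_submod S).

Lemma lspan_gen (S : set V) s : S s -> s \in lspan S.
Proof. by move=> Ss; apply/asboolP => N; exact. Qed.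

End Span.

Section FglinearLift.
Context (K : nzRingType) (T : choiceType) (M : lmodType K) (f : T -> M).

Lemma freegUZ (c : K) (x : T) : << c *g x >> = c *: << x >>.
Proof.
by apply/eqP/freeg_eqP => y; rewrite coeffZ !coeffU mul1r.
Qed.

Fact fglift_linear : linear (@fglift K M T f).
Proof.
have h : additive (@fglift K M T f) by exact: lift_is_additive.
have f0 : fglift f 0 = 0 by rewrite -[0 in LHS](subrr 0) h subrr.
have fN x : fglift f (- x) = - fglift f x.
  by rewrite -[in LHS](sub0r x) h f0 sub0r.
have fD x y : fglift f (x + y) = fglift f x + fglift f y.
  by rewrite -[in LHS](opprK y) h fN opprK.
have fs (s : seq T) (F : T -> {freeg T / K}) :
    fglift f (\sum_(x <- s) F x) = \sum_(x <- s) fglift f (F x).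
  by elim: s => [|x s IH]; rewrite ?big_nil// !big_cons fD IH.
move=> a x y; rewrite fD; congr (_ + _).
rewrite -[in LHS](freeg_sumE x) -[in RHS](freeg_sumE x) scaler_sumr !fs.
rewrite scaler_sumr; apply: eq_bigr => z _.
have -> (c : K) : a *: << c *g z >> = << (a * c) *g z >>.
  by apply/eqP/freeg_eqP => w; rewrite coeffZ !coeffU mulrA.
by rewrite !liftU scalerA.
Qed.

HB.instance Definition _ := GRing.isLinear.Build K {freeg T / K} M *:%R
  (@fglift K M T f) fglift_linear.

End FglinearLift.

Section AlgebraicTensor.
Context (K : nzRingType) (Y X : lmodType K).

Definition free_mod : lmodType K := {freeg (Y * X) / K}.

Definition free_gen (y : Y) (x : X) : free_mod := << (y, x) >>.

Inductive tensor_rel : free_mod -> Prop :=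
| TensorRelL (a : K) y y' x : tensor_rel
  (free_gen (a *: y + y') x - (a *: free_gen y x + free_gen y' x))
| TensorRelR (a : K) y x x' : tensor_rel
  (free_gen y (a *: x + x') - (a *: free_gen y x + free_gen y x')).

Definition tensor : lmodType K := lquot (lspan tensor_rel).

Definition tensor_pi : free_mod -> tensor := lquot_pi (lspan tensor_rel).

HB.instance Definition _ := GRing.isLinear.Build K free_mod tensor *:%R
  tensor_pi (lquot_pi_linear (lspan tensor_rel)).

Definition tens (y : Y) (x : X) : tensor := tensor_pi (free_gen y x).

Fact tens_linearl x : linear (tens^~ x).
Proof.
move=> a y y'; rewrite -linearP; apply/lquot_piP/lspan_gen.
exact: TensorRelL.
Qed.

Fact tens_linearr y : linear (tens y).
Proof.
move=> a x x'; rewrite -linearP; apply/lquot_piP/lspan_gen.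
exact: TensorRelR.
Qed.

Lemma tensZl a y x : tens (a *: y) x = a *: tens y x.
Proof.
have t0 : tens 0 x = 0.
  have := tens_linearl x 1 0 0; rewrite scaler0 addr0 scale1r => /eqP.
  by rewrite -subr_eq0 opprD addrA subrr add0r oppr_eq0 => /eqP.
by have := tens_linearl x a y 0; rewrite addr0 /= t0 addr0.
Qed.

Lemma tensZr a y x : tens y (a *: x) = a *: tens y x.
Proof.
have t0 : tens y 0 = 0.
  have := tens_linearr y 1 0 0; rewrite scaler0 addr0 scale1r => /eqP.
  by rewrite -subr_eq0 opprD addrA subrr add0r oppr_eq0 => /eqP.
by have := tens_linearr y a x 0; rewrite addr0 /= t0 addr0.
Qed.

Lemma free_mod_sum (D : free_mod) :
  D = \sum_(z <- dom D) coeff z D *: free_gen z.1 z.2.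
Proof.
suff : D = \sum_(z <- dom D) coeff z D *: << (z.1, z.2) >> :> {freeg (Y * X) / K}.
  by [].
rewrite -[LHS](freeg_sumE D); apply: eq_bigr => -[y x] _.
exact: freegUZ.
Qed.

Lemma tensor_sum (t : tensor) : exists s : seq (K * Y * X),
  t = \sum_(i <- s) i.1.1 *: tens i.1.2 i.2.
Proof.
have [D ->] : exists D, t = tensor_pi D.
  by elim/lquot_ind: t => D; exists D.
exists [seq (coeff z D, z.1, z.2) | z <- dom D].
rewrite [in LHS](free_mod_sum D).
by rewrite [in RHS]big_map linear_sum; apply: eq_bigr => z _; rewrite linearZ.
Qed.

End AlgebraicTensor.

Section AlgebraicTensorMap.
Context (K : nzRingType) (Y1 Y2 X : lmodType K) (f : {linear Y1 -> Y2}).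

Definition free_map : free_mod Y1 X -> free_mod Y2 X :=
  fglift (fun z => free_gen (f z.1) z.2).

HB.instance Definition _ := GRing.isLinear.Build K (free_mod Y1 X)
  (free_mod Y2 X) *:%R free_map (fglift_linear _).

Lemma free_mapE y x : free_map (free_gen y x) = free_gen (f y) x.
Proof. by rewrite [LHS]liftU scale1r. Qed.

Fact free_map_rel D : D \in lspan (@tensor_rel K Y1 X) ->
  free_map D \in lspan (@tensor_rel K Y2 X).
Proof.
move=> /asboolP DN; pose P : {pred free_mod Y1 X} :=
  fun D => free_map D \in lspan (@tensor_rel K Y2 X).
have PE D' : (D' \in P) = (free_map D' \in lspan (@tensor_rel K Y2 X)) by [].
have PP : submod_closed P.
  split; first by rewrite PE linear0 rpred0.
  by move=> a x y; rewrite !PE => Px Py; rewrite linearP rpredD ?rpredZ.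
pose N := GRing.isSubmodClosed.Build K (free_mod Y1 X) P PP.
pose NP : submodClosed (free_mod Y1 X) := HB.pack P N.
have h s : tensor_rel s -> s \in P; last exact: (DN NP h).
case=> [a y y' x|a y x x']; rewrite PE linearB linearP /= !free_mapE ?(linearP f); apply: lspan_gen; constructor.
Qed.

Definition tensor_map : tensor Y1 X -> tensor Y2 X :=
  lquot_map (lspan (@tensor_rel K Y2 X)) free_map.

Fact tensor_map_linear : linear tensor_map.
Proof. exact: lquot_map_linear free_map_rel. Qed.

HB.instance Definition _ := GRing.isLinear.Build K (tensor Y1 X) (tensor Y2 X)
  *:%R tensor_map tensor_map_linear.

Lemma tensor_mapE y x : tensor_map (tens y x) = tens (f y) x.
Proof. by rewrite [LHS](lquot_mapE free_map_rel) /= free_mapE. Qed.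

End AlgebraicTensorMap.
Arguments tensor_map {K Y1 Y2} X f.

Section ProjectiveTopology.
Context (K : numFieldType) (Y X : tvsType K).

(* The absolutely convex hull of [U ⊗ W]; for [U] and [W] neighborhoods of 0,
   these sets form a base at 0 of the projective topology. *)
Definition proj_set (U : set Y) (W : set X) : set (tensor Y X) :=
  [set t | exists s : seq (K * Y * X), [/\
    forall i, i \in s -> U i.1.2 /\ W i.2,
    \sum_(i <- s) `|i.1.1| <= 1 &
    t = \sum_(i <- s) i.1.1 *: tens i.1.2 i.2]].

Definition proj_sets (S : set (tensor Y X)) : Prop :=
  exists U W, [/\ nbhs 0 U, nbhs 0 W & S = proj_set U W].

Fact proj_ex : exists S, proj_sets S.
Proof.
by exists (proj_set setT setT), setT, setT; split=> //; exact: filterT.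
Qed.

Fact proj_setI S T : proj_sets S -> proj_sets T ->
  exists2 Z, proj_sets Z & Z `<=` S `&` T.
Proof.
move=> [U [W [U0 W0 ->]]] [U' [W' [U'0 W'0 ->]]].
exists (proj_set (U `&` U') (W `&` W')).
  by exists (U `&` U'), (W `&` W'); split=> //; exact: filterI.
by move=> t [s [sU s1 ->]]; split; exists s; split=> // i /sU[[? ?] []].
Qed.

Fact proj_absconvex S x y (a b : K) : proj_sets S -> S x -> S y ->
  `|a| + `|b| <= 1 -> S (a *: x + b *: y).
Proof.
move=> [U [W [U0 W0 ->]]] [s [sU s1 ->]] [t [tU t1 ->]] ab.
exists ([seq (a * i.1.1, i.1.2, i.2) | i <- s] ++
        [seq (b * i.1.1, i.1.2, i.2) | i <- t]); split.
- by move=> i; rewrite mem_cat => /orP[] /mapP[j js ->]; [exact: (sU j)|exact: (tU j)].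
- rewrite big_cat !big_map /= (le_trans _ ab)//; apply: lerD.
    under eq_bigr do rewrite normrM.
    by rewrite -mulr_sumr ler_piMr.
  under eq_bigr do rewrite normrM.
  by rewrite -mulr_sumr ler_piMr.
- rewrite big_cat !big_map /= !scaler_sumr.
  by congr (_ + _); apply: eq_bigr => i _; rewrite scalerA.
Qed.

Lemma tvs_absorbing (E : tvsType K) (U : set E) (x : E) : nbhs 0 U ->
  exists2 e : K, e != 0 & U (e *: x).
Proof.
move=> U0; have := @scale_continuous K E (0, x) U.
rewrite /= scale0r => /(_ U0) [[A B] /= [[r /= r0 rA] Bx] AB].
have r20 : 0 < r / 2 by rewrite divr_gt0.
exists (r / 2); first by rewrite gt_eqF.
apply: (AB (r / 2, x)); split => /=; last exact: nbhs_singleton.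
by apply: rA; rewrite /= sub0r normrN gtr0_norm// ltr_pdivrMr// ltr_pMr// ltr1n.
Qed.

Fact proj_absorbing S x : proj_sets S -> exists2 e : K, e != 0 & S (e *: x).
Proof.
move=> [U [W [U0 W0 ->]]]; have [s ->] := tensor_sum x.
have [t [tU ->]] : exists t : seq (K * Y * X),
    (forall i, i \in t -> U i.1.2 /\ W i.2) /\
    \sum_(i <- s) i.1.1 *: tens i.1.2 i.2 =
    \sum_(i <- t) i.1.1 *: tens i.1.2 i.2.
  elim: s => [|i s [t [tU IH]]]; first by exists [::].
  have [e e0 Ue] := tvs_absorbing i.1.2 U0.
  have [d d0 Wd] := tvs_absorbing i.2 W0.
  exists ((i.1.1 / (e * d), e *: i.1.2, d *: i.2) :: t); split.
    by move=> j; rewrite inE => /predU1P[->//|/tU].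
  rewrite !big_cons IH /= tensZl tensZr !scalerA.
  by rewrite divfK// mulf_neq0.
have m0 : 0 <= \sum_(i <- t) `|i.1.1| by apply: sumr_ge0.
have M0 : 0 < 1 + \sum_(i <- t) `|i.1.1| by rewrite ltr_wpDr.
exists (1 + \sum_(i <- t) `|i.1.1|)^-1; first by rewrite invr_eq0 gt_eqF.
exists [seq ((1 + \sum_(i <- t) `|i.1.1|)^-1 * i.1.1, i.1.2, i.2) | i <- t].
split.
- by move=> i /mapP[j js ->]; exact: (tU j).
- rewrite big_map /=; under eq_bigr do rewrite normrM.
  rewrite -mulr_sumr normfV gtr0_norm// mulrC ler_pdivrMr// mul1r.
  by rewrite lerDr.
- by rewrite big_map scaler_sumr; apply: eq_bigr => i _; rewrite scalerA.
Qed.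

Fact proj_homothety S (a : K) : proj_sets S ->
  exists2 T, proj_sets T & forall x, T x -> S (a *: x).
Proof.
move=> [U [W [U0 W0 ->]]].
pose U' := [set y : Y | U (a *: y)].
have U'0 : nbhs 0 U'.
  have := @scale_continuous K Y (a, 0) U.
  rewrite /= scaler0 => /(_ U0) [[A B] /= [Aa B0] AB].
  apply: (filterS _ B0) => y By; apply: (AB (a, y)); split => //=.
  exact: (nbhs_singleton Aa).
exists (proj_set U' W); first by exists U', W.
move=> _ [s [sU s1 ->]].
exists [seq (i.1.1, a *: i.1.2, i.2) | i <- s]; split.
- by move=> i /mapP[j /sU[]? ? ->].
- by rewrite big_map.
- rewrite big_map scaler_sumr; apply: eq_bigr => i _ /=.
  by rewrite tensZl !scalerA mulrC.
Qed.

Definition proj_base : lcBase (tensor Y X) :=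
  LcBase proj_ex proj_setI proj_absconvex proj_absorbing proj_homothety.

Definition ctensor : tvsType K := lctype (completion_base proj_base).

Definition ctens (y : Y) (x : X) : ctensor :=
  to_completion proj_base (tens y x).

End ProjectiveTopology.

Section CompletedTensorMap.
Context (K : numFieldType) (Y1 Y2 X : tvsType K) (f : {linear Y1 -> Y2}).
Context (fc : continuous f).

Lemma tensor_map_cont :
  lc_cont (proj_base Y1 X) (proj_base Y2 X) (tensor_map X f).
Proof.
move=> _ [U [W [U0 W0 ->]]]; exists (proj_set (f @^-1` U) W).
  by exists (f @^-1` U), W; split=> //; apply: fc; rewrite linear0.
move=> _ [s [sU s1 ->]]; exists [seq (i.1.1, f i.1.2, i.2) | i <- s]; split.
- by move=> i /mapP[j js ->]; exact: (sU j).
- by rewrite big_map.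
- rewrite linear_sum big_map; apply: eq_bigr => i _.
  by rewrite linearZ /= tensor_mapE.
Qed.

Definition ctensor_map : ctensor Y1 X -> ctensor Y2 X :=
  completion_map tensor_map_cont.

HB.instance Definition _ := GRing.isLinear.Build K (ctensor Y1 X) (ctensor Y2 X)
  *:%R ctensor_map (completion_map_linear tensor_map_cont).

Lemma ctensor_mapE y x : ctensor_map (ctens y x) = ctens (f y) x.
Proof. by rewrite [LHS]completion_map_to /= tensor_mapE. Qed.

Lemma ctensor_map_continuous : continuous ctensor_map.
Proof.
apply: (iffLR (lc_contP (completion_base (proj_base Y1 X))
  (completion_base (proj_base Y2 X)) ctensor_map)).
exact: completion_map_cont.
Qed.

End CompletedTensorMap.
Arguments ctensor_map {K Y1 Y2} X {f} fc.

Section ClosedSpan.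
Context (K : numFieldType) (E : tvsType K).

Definition closed_span (S : set E) : {pred E} := fun x =>
  `[< forall N : submodClosed E, closed [set y | y \in N] ->
      (forall s, S s -> s \in N) -> x \in N >].

Fact closed_span_submod S : submod_closed (closed_span S).
Proof.
split; first by apply/asboolP => N _ _; exact: rpred0.
move=> a x y /asboolP Sx /asboolP Sy; apply/asboolP => N Nc SN.
by rewrite rpredD ?rpredZ//; [exact: Sx|exact: Sy].
Qed.

HB.instance Definition _ S :=
  GRing.isSubmodClosed.Build K E (closed_span S) (closed_span_submod S).

Lemma closed_span_gen (S : set E) s : S s -> s \in closed_span S.
Proof. by move=> Ss; apply/asboolP => N _; exact. Qed.

Lemma closed_span_closed (S : set E) : closed [set y | y \in closed_span S].
Proof.
move=> x clx; apply/asboolP => N Nc SN; apply: (Nc).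
by apply: closureS clx => y /= /asboolP; apply.
Qed.

End ClosedSpan.

Lemma closed_span_map (K : numFieldType) (E F : tvsType K) (f : {linear E -> F})
    (S : set E) (T : set F) :
  continuous f -> (forall s, S s -> T (f s)) ->
  forall x, x \in closed_span S -> f x \in closed_span T.
Proof.
move=> fc ST x /asboolP Sx; pose P : {pred E} := fun y => f y \in closed_span T.
have PE y : (y \in P) = (f y \in closed_span T) by [].
have PP : submod_closed P.
  split; first by rewrite PE linear0 rpred0.
  by move=> a y z; rewrite !PE => Py Pz; rewrite linearP rpredD ?rpredZ.
pose N := GRing.isSubmodClosed.Build K E P PP.
pose NP : submodClosed E := HB.pack P N.
rewrite -PE; apply: (Sx NP) => [|s Ss].
  exact: ((continuous_closedP f).1 fc _ (@closed_span_closed K F T)).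
exact/closed_span_gen/ST.
Qed.

(* Completeness is required with respect to the translation-invariant
   uniformity: the uniform structure carried by a [tvsType] is only required to
   induce its topology. As the topology is first countable, it is enough to
   consider sequences. *)
Definition frechet (K : numFieldType) (E : tvsType K) : Prop :=
  [/\ hausdorff_space E,
      exists B : nat -> set E, (forall n, nbhs 0 (B n)) /\
        (forall U, nbhs 0 U -> exists n, B n `<=` U) &
      forall u : nat -> E,
        (forall U, nbhs 0 U -> exists n0, forall m n,
           (n0 <= m)%N -> (n0 <= n)%N -> U (u m - u n)) ->
        exists l : E, u @ \oo --> l].

(* Not necessarily unital. *)
Record banachAlgebra (K : numFieldType) := BanachAlgebra {
  ba_space :> completeNormedModType K;
  ba_mul : ba_space -> ba_space -> ba_space;
  ba_mul_linearl : forall y, linear (ba_mul^~ y);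
  ba_mul_linearr : forall x, linear (ba_mul x);
  ba_mulA : associative ba_mul;
  ba_mul_norm : forall x y, `|ba_mul x y| <= `|x| * `|y|
}.

Section Modules.
Context (K : numFieldType) (A : banachAlgebra K).

Record right_action (Y : tvsType K) := RightAction {
  ract : Y -> A -> Y;
  ract_linearl : forall a, linear (ract^~ a);
  ract_linearr : forall y, linear (ract y);
  ractA : forall y a b, ract (ract y a) b = ract y (ba_mul a b);
  ract_continuous : continuous (fun p : Y * A => ract p.1 p.2)
}.

Record left_action (X : tvsType K) := LeftAction {
  lact : A -> X -> X;
  lact_linearl : forall x, linear (lact^~ x);
  lact_linearr : forall a, linear (lact a);
  lactA : forall a b x, lact a (lact b x) = lact (ba_mul a b) x;
  lact_continuous : continuous (fun p : A * X => lact p.1 p.2)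
}.

Record rightFrechetMod := RightFrechetMod {
  rfm_space :> tvsType K;
  rfm_frechet : frechet rfm_space;
  rfm_act : right_action rfm_space
}.

Record leftFrechetMod := LeftFrechetMod {
  lfm_space :> tvsType K;
  lfm_frechet : frechet lfm_space;
  lfm_act : left_action lfm_space
}.

Record rightBanachMod := RightBanachMod {
  rbm_space :> completeNormedModType K;
  rbm_act : right_action rbm_space
}.

Record leftBanachMod := LeftBanachMod {
  lbm_space :> completeNormedModType K;
  lbm_act : left_action lbm_space
}.

Record rmod_hom (Y1 Y2 : rightFrechetMod) := RModHom {
  rhom_fun :> {linear Y1 -> Y2};
  rhom_continuous : continuous rhom_fun;
  rhom_act : forall y a,
    rhom_fun (ract (rfm_act Y1) y a) = ract (rfm_act Y2) (rhom_fun y) a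
}.

Section TensorOverA.
Context (Y : rightFrechetMod) (X : leftFrechetMod).

Definition balancing : set (ctensor Y X) :=
  [set t | exists y a x,
    t = ctens (ract (rfm_act Y) y a) x - ctens y (lact (lfm_act X) a x)].

Definition tensorA : lmodType K := lquot (closed_span balancing).

End TensorOverA.

Section TensorOverAMap.
Context (Y1 Y2 : rightFrechetMod) (f : rmod_hom Y1 Y2) (X : leftFrechetMod).

Definition tensorA_map : tensorA Y1 X -> tensorA Y2 X :=
  lquot_map (closed_span (@balancing Y2 X))
    (ctensor_map X (@rhom_continuous _ _ f)).

Fact tensorA_map_closed_span t : t \in closed_span (@balancing Y1 X) ->
  ctensor_map X (@rhom_continuous _ _ f) t \in
    closed_span (@balancing Y2 X).
Proof.
apply: closed_span_map; first exact: ctensor_map_continuous.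
move=> _ [y [a [x ->]]]; exists (f y), a, x.
by rewrite linearB /= !ctensor_mapE rhom_act.
Qed.

Fact tensorA_map_linear : linear tensorA_map.
Proof. exact: lquot_map_linear tensorA_map_closed_span. Qed.

HB.instance Definition _ := GRing.isLinear.Build K (tensorA Y1 X) (tensorA Y2 X)
  *:%R tensorA_map tensorA_map_linear.

Lemma tensorA_mapE y x :
  tensorA_map (lquot_pi _ (ctens y x)) = lquot_pi _ (ctens (f y) x).
Proof. by rewrite [LHS](lquot_mapE tensorA_map_closed_span) /= ctensor_mapE. Qed.

End TensorOverAMap.

End Modules.
Arguments tensorA_map {K A Y1 Y2} f X.

Definition short_exact (K : nzRingType) (V1 V2 V3 : lmodType K)
    (f : {linear V1 -> V2}) (g : {linear V2 -> V3}) : Prop :=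
  [/\ injective f,
      forall v, g v = 0 <-> exists u, f u = v &
      forall w, exists v, g v = w].

Definition topologically_split (K : numFieldType) (Y1 Y2 Y3 : tvsType K)
    (f : {linear Y1 -> Y2}) (g : {linear Y2 -> Y3}) : Prop :=
  exists (r : {linear Y2 -> Y1}) (s : {linear Y3 -> Y2}),
    [/\ continuous r, continuous s,
        forall y, r (f y) = y, forall y, g (s y) = y &
        forall y, f (r y) + s (g y) = y].

Section BanachFrechet.
Context (R : realType).
Local Notation C := R[i].

Lemma banach_frechet (E : completeNormedModType C) : frechet E.
Proof.
split; first exact: norm_hausdorff.
  exists (fun n => ball (0 : E) n.+1%:R^-1); split=> [n|U].
    by apply: nbhsx_ballx; rewrite invr_gt0 ltr0n.
  rewrite -nbhs_ballE => -[e /= e0 eU].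
  have [d d0 de] : exists2 d : R, 0 < d & d%:C%C <= e.
    by case: e e0 {eU} => a b; rewrite ltcE /= => /andP[/eqP -> a0]; exists a.
  have [n _ /(_ n (leqnn n)) /= nd] := near_infty_natSinv_lt (PosNum d0).
  exists n => x xn; apply: eU; apply: le_ball xn.
  apply: le_trans de; rewrite (_ : n.+1%:R^-1 = (n.+1%:R^-1 : R)%:C%C).
    by rewrite lecR ltW.
  by rewrite fmorphV rmorph_nat.
move=> u uc; apply/cvg_ex; apply: cauchy_cvg; apply: cauchy_exP => e e0.
have [|n0 un] := uc (ball 0 e); first exact: nbhsx_ballx.
exists (u n0), n0 => // n /= n0n.
by have := un n0 n (leqnn _) n0n; rewrite -!ball_normE /= sub0r normrN.
Qed.

Context (A : banachAlgebra C).

Definition right_frechet_of_banach (Y : rightBanachMod A) : rightFrechetMod A :=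
  RightFrechetMod (banach_frechet Y) (rbm_act Y).

Definition left_frechet_of_banach (X : leftBanachMod A) : leftFrechetMod A :=
  LeftFrechetMod (banach_frechet X) (lbm_act X).

End BanachFrechet.

Definition frechet_flat (R : realType) (A : banachAlgebra R[i])
    (X : leftFrechetMod A) : Prop :=
  forall (Y1 Y2 Y3 : rightFrechetMod A)
    (f : rmod_hom Y1 Y2) (g : rmod_hom Y2 Y3),
  short_exact f g -> topologically_split f g ->
  short_exact (tensorA_map f X) (tensorA_map g X).

Definition banach_flat (R : realType) (A : banachAlgebra R[i])
    (X : leftBanachMod A) : Prop :=
  forall (Y1 Y2 Y3 : rightBanachMod A)
    (f : rmod_hom (right_frechet_of_banach Y1) (right_frechet_of_banach Y2))
    (g : rmod_hom (right_frechet_of_banach Y2) (right_frechet_of_banach Y3)),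
  short_exact f g -> topologically_split f g ->
  short_exact (tensorA_map f (left_frechet_of_banach X))
              (tensorA_map g (left_frechet_of_banach X)).

(* Main.v *)
(* Exactness of [0 -> Y1 (x)_A X -> Y2 (x)_A X -> Y3 (x)_A X -> 0] is a statement
   about sequences in the algebraic tensor products [Yi (x) X]: Cauchy sequences
   modulo null ones, for the projective topology made coarser by the span of the
   [y a (x) x - y (x) a x].

   The Frechet case is an inverse limit of Banach cases. In a right Frechet module
   over a Banach algebra, the discs [D] with [D a `<=` D] for [|a| <= 1] form a base
   at 0, and completing with respect to the gauge of such a disc gives a Banach
   module. Let [r], [s] split the sequence. For such a disc [Q] of [Y1], take a disc
   [P] of [Y3] with [r (s z a) \in Q] for [z \in P] and [|a| <= 1]; then the gauge of
   [M = r^-1 Q `&` g^-1 P] is bounded for the action on [Y2], and the completions for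
   [Q], [M], [P] form a split exact sequence of Banach modules. Flatness for
   Banach modules gives exactness for the corresponding coarser topologies. As
   solutions at each level are unique up to null sequences, a diagonal argument
   (Mittag-Leffler) yields exactness in the limit. *)
Require Import Defs.
From HB Require Import structures.
From mathcomp Require Import all_boot all_order all_algebra.
From mathcomp Require Import complex freeg.
From mathcomp Require Import all_classical all_reals interval_inference convex.
From mathcomp Require Import topology normedtype.

Set Implicit Arguments.
Unset Strict Implicit.
Unset Printing Implicit Defensive.

Import Order.TTheory GRing.Theory Num.Theory.

Local Open Scope classical_set_scope.
Local Open Scope ring_scope.

(** * Sequences and bases of locally convex topologies *)

Section Sequences.
Context (K : numFieldType) (V : lmodType K) (b : lcBase V).
Implicit Types (u v w : nat -> V).

Definition lc_null u := forall U, b U -> exists n0, forall n, (n0 <= n)%N -> U (u n).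

Definition lc_cauchy u := forall U, b U ->
  exists n0, forall m n, (n0 <= m)%N -> (n0 <= n)%N -> U (u m - u n).

Lemma lc_opp U x : b U -> U x -> U (- x).
Proof. by move=> bU Ux; rewrite -scaleN1r; apply: (lc_balanced bU); rewrite ?normrN ?normr1. Qed.

Lemma lc_third U : b U ->
  exists2 W, b W & forall x y z, W x -> W y -> W z -> U (x + y + z).
Proof.
move=> bU; have [Z bZ ZU] := lc_half bU; have [W bW WZ] := lc_half bZ.
exists W => // x y z Wx Wy Wz; apply: ZU; first exact: WZ.
by rewrite -[z]addr0; apply: WZ => //; exact: lc_set0 bW.
Qed.

Lemma lc_nullP a u v : lc_null u -> lc_null v -> lc_null (fun n => a *: u n + v n).
Proof.
move=> nu nv U bU; have [W bW WU] := lc_lin a bU.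
have [n1 un] := nu W bW; have [n2 vn] := nv W bW.
by exists (maxn n1 n2) => n; rewrite geq_max => /andP[? ?]; apply: WU; auto.
Qed.

Lemma lc_null_ext u v : u =1 v -> lc_null u -> lc_null v.
Proof. by move=> /funext ->. Qed.

Lemma lc_null0 : lc_null (fun=> 0).
Proof. by move=> U bU; exists 0%N => n _; exact: lc_set0 bU. Qed.

Lemma lc_nullD u v : lc_null u -> lc_null v -> lc_null (fun n => u n + v n).
Proof.
by move=> nu nv; apply: lc_null_ext (lc_nullP 1 nu nv) => n; rewrite scale1r.
Qed.

Lemma lc_nullN u : lc_null u -> lc_null (fun n => - u n).
Proof.
move=> nu; apply: lc_null_ext (lc_nullP (-1) nu lc_null0) => n.
by rewrite scaleN1r addr0.
Qed.

Lemma lc_nullB u v : lc_null u -> lc_null v -> lc_null (fun n => u n - v n).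
Proof. by move=> nu nv; apply: lc_nullD nu (lc_nullN nv). Qed.

Lemma lc_nullC u v : lc_null (fun n => u n - v n) -> lc_null (fun n => v n - u n).
Proof. by move/lc_nullN; apply: lc_null_ext => n; rewrite opprB. Qed.

Lemma lc_null_trans v u w : lc_null (fun n => u n - v n) ->
  lc_null (fun n => v n - w n) -> lc_null (fun n => u n - w n).
Proof.
move=> uv vw; apply: lc_null_ext (lc_nullD uv vw) => n.
by rewrite addrA subrK.
Qed.

Lemma lc_cauchyP a u v : lc_cauchy u -> lc_cauchy v ->
  lc_cauchy (fun n => a *: u n + v n).
Proof.
move=> cu cv U bU; have [W bW WU] := lc_lin a bU.
have [n1 un] := cu W bW; have [n2 vn] := cv W bW.
exists (maxn n1 n2) => m n; rewrite !geq_max => /andP[? ?] /andP[? ?].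
rewrite (_ : _ - _ = a *: (u m - u n) + (v m - v n)); last first.
  by rewrite scalerBr opprD addrACA.
by apply: WU; auto.
Qed.

Lemma lc_cauchyD u v : lc_cauchy u -> lc_cauchy v -> lc_cauchy (fun n => u n + v n).
Proof.
move=> nu nv; have := lc_cauchyP 1 nu nv; congr lc_cauchy.
by apply/funext => n; rewrite scale1r.
Qed.

Lemma lc_null_cauchy u : lc_null u -> lc_cauchy u.
Proof.
move=> nu U bU; have [W bW WU] := lc_lin (-1) bU.
have [n0 un] := nu W bW; exists n0 => m n ? ?.
by rewrite addrC -scaleN1r; apply: WU; exact: un.
Qed.

Lemma lc_cauchyB u v : lc_cauchy u -> lc_cauchy v -> lc_cauchy (fun n => u n - v n).
Proof.
move=> nu nv; have := lc_cauchyP (-1) nv nu; congr lc_cauchy.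
by apply/funext => n; rewrite scaleN1r addrC.
Qed.

Lemma lc_cauchy_null u v : lc_cauchy u -> lc_null (fun n => v n - u n) -> lc_cauchy v.
Proof.
move=> cu /lc_null_cauchy vu; have := lc_cauchyD vu cu; congr lc_cauchy.
by apply/funext => n; rewrite subrK.
Qed.

Lemma lc_cauchy_subseq u (k : nat -> nat) : lc_cauchy u ->
  (forall n, (n <= k n)%N) -> lc_null (fun n => u n - u (k n)).
Proof.
move=> cu nk U bU; have [n0 un] := cu U bU; exists n0 => n n0n.
by apply: un => //; exact: leq_trans (nk n).
Qed.

Lemma lc_cauchy_in_seq u : lc_cauchy u <-> u \in cauchy_seq b.
Proof. by split=> [cu|/asboolP//]; apply/asboolP. Qed.

(** Inclusion is required for all large indices, so that any choice of one element in each [S n] is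
    a null sequence. *)
Definition lc_countable : Prop := exists2 S : nat -> set V,
  forall n, b (S n) & forall U, b U -> exists n0, forall n, (n0 <= n)%N -> S n `<=` U.

Lemma lc_countableW (S : nat -> set V) : (forall n, b (S n)) ->
  (forall U, b U -> exists n, S n `<=` U) -> lc_countable.
Proof.
move=> bS SU.
have step (p : nat * set V) : exists Z : set V,
    b p.2 -> b Z /\ Z `<=` S p.1 `&` p.2.
  (* The value [setT] outside the base is a dummy: the recursion below never leaves the base. *)
  have [bU|] := pselect (b p.2); last by exists setT.
  by have [Z bZ ZU] := lc_setI (bS p.1) bU; exists Z.
have {step} [F FP] := choice step.
pose Z := fix Z n := if n is n'.+1 then F (n, Z n') else S 0%N.
have bZ n : b (Z n) by elim: n => [|n IH] /=; [exact: bS|case: (FP (n.+1, Z n) IH)].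
have ZS n : Z n `<=` S n.
  by case: n => [|n] // x; have [_ h] := FP (n.+1, Z n) (bZ n); move=> /h[].
have Zle n m : (n <= m)%N -> Z m `<=` Z n.
  move=> /subnKC <-; elim: (m - n)%N => [|k IH]; rewrite ?addn0// addnS => x.
  by have [_ h] := FP ((n + k).+1, Z (n + k)%N) (bZ _); move=> /h[_ /IH].
exists Z => // U /SU[n0 h]; exists n0 => n /Zle n0n x /n0n /ZS; exact: h.
Qed.

End Sequences.

Section Continuity.
Context (K : numFieldType) (V W : lmodType K) (b : lcBase V) (c : lcBase W).
Context (f : {linear V -> W}) (fc : lc_cont b c f).

Lemma lc_cont_null u : lc_null b u -> lc_null c (f \o u).
Proof.
move=> nu U cU; have [Z bZ ZU] := fc cU.
by have [n0 un] := nu _ bZ; exists n0 => n ?; apply/ZU/un.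
Qed.

Lemma lc_cont_cauchy u : lc_cauchy b u -> lc_cauchy c (f \o u).
Proof.
move=> nu U cU; have [Z bZ ZU] := fc cU.
by have [n0 un] := nu _ bZ; exists n0 => m n ? ? /=; rewrite -linearB; apply/ZU/un.
Qed.

End Continuity.

(** * Initial topology along a linear map *)

Section Preimage.
Context (K : numFieldType) (V W : lmodType K) (f : {linear V -> W}) (c : lcBase W).

Definition preim_sets (S : set V) : Prop := exists2 U, c U & S = f @^-1` U.

Fact preim_ex : exists S, preim_sets S.
Proof. by have [U cU] := lc_ex c; exists (f @^-1` U), U. Qed.

Fact preim_setI S T : preim_sets S -> preim_sets T ->
  exists2 Z, preim_sets Z & Z `<=` S `&` T.
Proof.
move=> [U cU ->] [U' cU' ->]; have [Z cZ ZU] := lc_setI cU cU'.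
by exists (f @^-1` Z); [exists Z|move=> x /ZU].
Qed.

Fact preim_absconvex S x y (a a' : K) : preim_sets S -> S x -> S y ->
  `|a| + `|a'| <= 1 -> S (a *: x + a' *: y).
Proof.
move=> [U cU ->] Ux Uy aa'; rewrite /preimage /= linearP linearZ.
exact: (lc_absconvex cU).
Qed.

Fact preim_absorbing S x : preim_sets S -> exists2 e : K, e != 0 & S (e *: x).
Proof.
move=> [U cU ->]; have [e e0 Ue] := lc_absorbing (f x) cU.
by exists e; rewrite // /preimage /= linearZ.
Qed.

Fact preim_homothety S (a : K) : preim_sets S ->
  exists2 T, preim_sets T & forall x, T x -> S (a *: x).
Proof.
move=> [U cU ->]; have [Z cZ ZU] := lc_homothety a cU.
exists (f @^-1` Z); first by exists Z.
by move=> x /ZU; rewrite /preimage /= linearZ.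
Qed.

Definition lc_preim : lcBase V := LcBase
  preim_ex preim_setI preim_absconvex preim_absorbing preim_homothety.

Lemma lc_preim_null u : lc_null lc_preim u <-> lc_null c (f \o u).
Proof.
split=> nu U; first by move=> cU; apply: (nu (f @^-1` U)); exists U.
by case=> S cS ->; exact: nu.
Qed.

Lemma lc_preim_cauchy u : lc_cauchy lc_preim u <-> lc_cauchy c (f \o u).
Proof.
split=> nu U.
  move=> cU; have [|n0 h] := nu (f @^-1` U); first by exists U.
  by exists n0 => m n ? ? /=; rewrite -linearB; exact: h.
case=> S /nu [n0 h] ->; exists n0 => m n ? ?.
by rewrite /preimage /= linearB; exact: h.
Qed.

End Preimage.

(** * Topologies made coarser by a submodule, and lifting of Cauchy sequences *)

Section SubmoduleSum.
Context (K : numFieldType) (V : lmodType K) (b : lcBase V) (N : submodClosed V).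

(** The sets [U + N]: they define the quotient topology of [V / N] pulled back to [V], so the
    closure of 0 becomes the closure of [N]. *)
Definition mod_sets (S : set V) : Prop :=
  exists2 U, b U & S = [set x | exists2 m, m \in N & U (x - m)].

Fact mod_ex : exists S, mod_sets S.
Proof. by have [U bU] := lc_ex b; eexists; exists U. Qed.

Fact mod_setI S T : mod_sets S -> mod_sets T ->
  exists2 Z, mod_sets Z & Z `<=` S `&` T.
Proof.
move=> [U bU ->] [U' bU' ->]; have [Z bZ ZU] := lc_setI bU bU'.
eexists; first by exists Z.
by move=> x [m mN /ZU[? ?]]; split; exists m.
Qed.

Fact mod_absconvex S x y (a a' : K) : mod_sets S -> S x -> S y ->
  `|a| + `|a'| <= 1 -> S (a *: x + a' *: y).
Proof.
move=> [U bU ->] [m mN Ux] [m' m'N Uy] aa'.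
exists (a *: m + a' *: m'); first by rewrite rpredD// rpredZ.
rewrite opprD addrACA -!scalerBr; exact: (lc_absconvex bU).
Qed.

Fact mod_absorbing S x : mod_sets S -> exists2 e : K, e != 0 & S (e *: x).
Proof.
move=> [U bU ->]; have [e e0 Ue] := lc_absorbing x bU.
by exists e => //; exists 0; rewrite ?rpred0// subr0.
Qed.

Fact mod_homothety S (a : K) : mod_sets S ->
  exists2 T, mod_sets T & forall x, T x -> S (a *: x).
Proof.
move=> [U bU ->]; have [Z bZ ZU] := lc_homothety a bU.
eexists; first by exists Z.
move=> x [m mN Zx]; exists (a *: m); first by rewrite rpredZ.
by rewrite -scalerBr; exact: ZU.
Qed.

Definition lc_mod : lcBase V := LcBase
  mod_ex mod_setI mod_absconvex mod_absorbing mod_homothety.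

Lemma lc_mod_coarser : lc_cont b lc_mod idfun.
Proof.
move=> _ [U bU ->]; exists U => // x Ux.
by exists 0; rewrite ?rpred0// subr0.
Qed.

Lemma lc_null_mod u : (forall n, u n \in N) -> lc_null lc_mod u.
Proof.
move=> uN _ [U bU ->]; exists 0%N => n _; exists (u n) => //.
by rewrite subrr; exact: lc_set0 bU.
Qed.

Lemma lc_mod_countable : lc_countable b -> lc_countable lc_mod.
Proof.
move=> [S bS SU]; exists (fun n => [set x | exists2 m, m \in N & S n (x - m)]).
  by move=> n; exists (S n).
move=> _ [U /SU[n0 h] ->]; exists n0 => n /h Un x [m mN /Un Um]; by exists m.
Qed.

(* The correction of Mittag-Leffler: the jumps of a fast subsequence are small
   up to elements of [N], which are subtracted one after the other. *)
Lemma lc_cauchy_lift u : lc_countable b -> lc_cauchy lc_mod u ->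
  exists2 v, lc_cauchy b v & lc_null lc_mod (fun n => u n - v n).
Proof.
move=> [S bS SU'] cu.
have SU U : b U -> exists n, S n `<=` U.
  by move=> /SU'[n /(_ n (leqnn n))]; exists n.
have step (k : nat) (U : set V) : exists Z : set V,
    b U -> [/\ b Z, Z `<=` S k & forall x y, Z x -> Z y -> U (x + y)].
  have [bU|] := pselect (b U); last by exists setT.
  have [Z bZ ZU] := lc_half bU; have [Z' bZ' Z'Z] := lc_setI bZ (bS k).
  by exists Z' => _; split=> // [x /Z'Z[]|x y /Z'Z[? _] /Z'Z[? _]] //; exact: ZU.
have {step} [F FP] := choice (fun p => step p.1 p.2).
(* Each [Z n.+1] lies in [S n] and satisfies [Z n.+1 + Z n.+1] in [Z n]; hence a sum of terms taken
   from [Z n.+1], [Z n.+2], and so on stays in [Z n]. *)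
pose Z := fix Z n := if n is n'.+1 then F (n', Z n') else S 0%N.
have bZ n : b (Z n) by elim: n => [|n IH] /=; [exact: bS|case: (FP (n, Z n) IH)].
have ZS n : Z n.+1 `<=` S n by case: (FP (n, Z n) (bZ n)).
have ZD n x y : Z n.+1 x -> Z n.+1 y -> Z n (x + y).
  by have [_ _] := FP (n, Z n) (bZ n); exact.
have Zle n k x : Z (n + k)%N x -> Z n x.
  elim: k x => [|k IH] x; rewrite ?addn0 // addnS => Zx; apply: IH.
  by rewrite -[x]addr0; apply: ZD => //; exact: lc_set0 (bZ _).
have tele n k (d : nat -> V) : (forall i, (i < k)%N -> Z (n.+1 + i)%N (d i)) ->
    Z n (\sum_(i < k) d i).
  elim: k n d => [|k IH] n d h.
    by rewrite big_ord0; exact: lc_set0 (bZ _).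
  rewrite big_ord_recl; apply: ZD; first by have := h 0%N isT; rewrite addn0.
  by apply: (IH n.+1 (fun i => d i.+1)) => i ik; have := h i.+1 ik; rewrite addnS.
have idx n : exists k, forall i j, (k <= i)%N -> (k <= j)%N ->
    exists2 m, m \in N & Z n (u i - u j - m).
  by apply: (cu [set x | exists2 m, m \in N & Z n (x - m)]); exists (Z n).
have {idx} [k kP] := choice idx.
(* The fast subsequence: past [l n], differences of terms of [u] lie in [Z n + N]. *)
pose l := fix l n := if n is n'.+1 then maxn (k n'.+1) (maxn (l n').+1 n'.+1) else k 0%N.
have lk n : (k n <= l n)%N by case: n => // n; rewrite /= leq_maxl.
have lS n : (l n <= l n.+1)%N.
  by rewrite /= !leq_max leqnSn !orbT.
have ln n : (n <= l n)%N by case: n => // n; rewrite /= !leq_max leqnn !orbT.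
have corr n : exists m, m \in N /\ Z n (u (l n.+1) - u (l n) - m).
  have [||m mN Zm] := kP n (l n.+1) (l n) _ _; last by exists m.
    exact: leq_trans (lS n).
  exact: lk.
have {corr} [m mP] := choice corr.
pose v n := u (l n) - \sum_(i < n) m i.
have vS n : Z n (v n.+1 - v n).
  have e (x y z t : V) : x - (z + t) - (y - z) = x - y - t.
    by rewrite opprB opprD !addrA (addrAC (x - z)) subrK addrAC.
  by rewrite /v big_ord_recr e; exact: (mP n).2.
have vD n i : Z n (v (n.+1 + i)%N - v n.+1).
  rewrite (_ : _ - _ = \sum_(j < i) (v (n.+1 + j).+1 - v (n.+1 + j)%N)).
    by apply: (tele n i (fun j => v (n.+1 + j).+1 - v (n.+1 + j)%N)) => j _; exact: vS.
  elim: i => [|i IH]; first by rewrite big_ord0 addn0 subrr.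
  by rewrite big_ord_recr /= -IH addnS [RHS]addrC addrA subrK.
exists v => [U bU|].
  have [n SUn] := SU U bU; have [W bW WS] := lc_lin (-1) (bS n).
  (* The shift by two: [vD n'.+1] puts the increments from index [n'.+2] on into [Z n'.+1], which
     lies in [S n']. *)
  have [n' SW] := SU W bW; exists n'.+2 => i j.
  have vW i' : (n'.+2 <= i')%N -> W (v i' - v n'.+2).
    by move=> /subnKC <-; apply/SW/ZS; exact: vD.
  move=> /vW Wi /vW Wj; apply: SUn.
  have := WS _ _ Wj Wi; congr (S n); rewrite scaleN1r opprB addrC addrA.
  by rewrite subrK.
have h := lc_cauchy_subseq cu ln.
apply: (lc_null_trans h); apply: lc_null_mod => n.
rewrite /v opprB addrC subrK; apply: rpred_sum => i _; exact: (mP i).1.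
Qed.

End SubmoduleSum.

Section CompletionSet.
Context (K : numFieldType) (V : lmodType K) (b : lcBase V).
Implicit Types (u v : cseq b).

Lemma cseq_cauchy u : lc_cauchy b u.
Proof. by move=> U bU; exact: cseqP. Qed.

Lemma null_seqP u : u \in @null_seq _ _ b <-> lc_null b u.
Proof. by split=> [/asboolP//|?]; apply/asboolP. Qed.

Lemma cseq_of (w : nat -> V) : lc_cauchy b w -> exists u : cseq b, w = u.
Proof. by move=> /lc_cauchy_in_seq cw; exists (CSeq cw). Qed.

Lemma completion_eqP u v :
  lquot_pi (@null_seq _ _ b) u = lquot_pi (@null_seq _ _ b) v <->
  lc_null b (fun n => u n - v n).
Proof. by rewrite lquot_piP; exact: null_seqP. Qed.

(** Replacing the term of index [n] by that of index [maxn n0 n] discards the early terms without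
    changing the class. *)
Lemma completion_set_eventually (U : set V) u n0 :
  (forall n, (n0 <= n)%N -> U (u n)) ->
  completion_set U (lquot_pi (@null_seq _ _ b) u).
Proof.
move=> Uu; have cu : lc_cauchy b (fun n => u (maxn n0 n)).
  move=> Z bZ; have [n1 h] := cseqP u bZ; exists n1 => m n m1 n1'.
  by apply: h; rewrite leq_max ?m1 ?n1' orbT.
have [v uv] := cseq_of cu; exists v; first by move=> n; rewrite -uv; apply: Uu; rewrite leq_maxl.
apply/completion_eqP; rewrite -uv; apply: lc_cauchy_subseq; first exact: cseq_cauchy.
by move=> n; rewrite leq_maxr.
Qed.

End CompletionSet.

(** * Exactness of completions in terms of sequences, and its passage to the limit *)

Section SequentialExactness.
Context (K : numFieldType) (V1 V2 V3 : lmodType K).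
Context (f : {linear V1 -> V2}) (g : {linear V2 -> V3}).

(* Exactness of [0 -> V1^ -> V2^ -> V3^], where [Vi^] is the Hausdorff
   completion of [Vi] for the base [ci]. *)
Definition seq_exact (c1 : lcBase V1) (c2 : lcBase V2) (c3 : lcBase V3) : Prop :=
  (forall u, lc_cauchy c1 u -> lc_null c2 (f \o u) -> lc_null c1 u) /\
  (forall u, lc_cauchy c2 u -> lc_null c3 (g \o u) ->
    exists2 w, lc_cauchy c1 w & lc_null c2 (fun n => f (w n) - u n)).

Context (c1 : lcBase V1) (c2 : lcBase V2) (c3 : lcBase V3).
Context (d1 : nat -> lcBase V1) (d2 : nat -> lcBase V2) (d3 : nat -> lcBase V3).
Hypothesis c1d : forall n, lc_cont c1 (d1 n) idfun.
Hypothesis c2d : forall n, lc_cont c2 (d2 n) idfun.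
Hypothesis c3d : forall n, lc_cont c3 (d3 n) idfun.
Hypothesis d1S : forall n, lc_cont (d1 n.+1) (d1 n) idfun.
Hypothesis d2S : forall n, lc_cont (d2 n.+1) (d2 n) idfun.
Hypothesis fd : forall n, lc_cont (d1 n) (d2 n) f.
Context (U : nat -> set V1).
Hypothesis Ud : forall n, d1 n (U n).
Hypothesis Uc : forall W, c1 W -> exists n0, forall n, (n0 <= n)%N -> U n `<=` W.
Hypothesis dc2 : forall W, c2 W -> exists n, exists2 Z, d2 n Z & Z `<=` W.
Hypothesis exd : forall n, seq_exact (d1 n) (d2 n) (d3 n).

Let d_le (V : lmodType K) (d : nat -> lcBase V) :
  (forall n, lc_cont (d n.+1) (d n) idfun) ->
  forall n m, (n <= m)%N -> lc_cont (d m) (d n) idfun.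
Proof.
move=> dS n m /subnKC <-; elim: (m - n)%N => [|k IH].
  by rewrite addn0 => W dW; exists W.
rewrite addnS => W /IH[Z dZ ZW]; have [Z' dZ' Z'Z] := dS _ _ dZ.
by exists Z' => // x /Z'Z /ZW.
Qed.

(* A diagonal argument: solutions at the level [n] are unique up to null
   sequences, so their terms of large index form a Cauchy sequence for [c1]. *)
Lemma seq_exact_limit : seq_exact c1 c2 c3.
Proof.
have null_d2 u : lc_null c2 u <-> forall n, lc_null (d2 n) u.
  split=> [nu n|nu W /dc2[n [Z dZ ZW]]]; first exact: (lc_cont_null (f := idfun) (@c2d n)).
  by have [n0 h] := nu n Z dZ; exists n0 => k /h /ZW.
split=> [u cu fu W cW|u cu gu].
  have [n /(_ n (leqnn n)) UW] := Uc cW.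
  have [n0 h] : exists n0, forall k, (n0 <= k)%N -> U n (u k).
    apply: (exd n).1 (Ud n); first exact: (lc_cont_cauchy (f := idfun) (@c1d n)).
    exact: (null_d2 _).1 fu n.
  by exists n0 => k /h /UW.
have cu_ n : lc_cauchy (d2 n) u by exact: (lc_cont_cauchy (f := idfun) (@c2d n)).
have gu_ n : lc_null (d3 n) (g \o u) by exact: (lc_cont_null (f := idfun) (@c3d n)).
have sol n : exists w, lc_cauchy (d1 n) w /\ lc_null (d2 n) (fun k => f (w k) - u k).
  by have [w ? ?] := (exd n).2 u (cu_ n) (gu_ n); exists w.
have {sol} [w wP] := choice sol.
have w_uniq n m : (n <= m)%N -> lc_null (d1 n) (fun k => w n k - w m k).
  move=> nm; apply: (exd n).1.
    apply: lc_cauchyB; first exact: (wP n).1.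
    exact: (lc_cont_cauchy (f := idfun) (d_le d1S nm) (wP m).1).
  have h : lc_null (d2 n) (fun k => f (w m k) - u k).
    exact: (lc_cont_null (f := idfun) (d_le d2S nm) (wP m).2).
  apply: lc_null_ext (lc_nullB (wP n).2 h) => k /=.
  by rewrite opprB addrA subrK linearB.
have idx n : exists k, forall i j, (k <= i)%N -> (k <= j)%N -> U n (w n i - w n j).
  exact: (wP n).1 (Ud n).
have {idx} [k kP] := choice idx.
(* The diagonal sequence: from index [k n] on, the solution [w n] of level [n] varies only within
   [U n]. *)
pose v n := w n (k n).
have cv : lc_cauchy c1 v.
  move=> W cW; have [W' cW' W'W] := lc_third cW; have [n0 UW'] := Uc cW'.
  suff h n m : (n0 <= n)%N -> (n <= m)%N -> W (v n - v m).
    exists n0 => n m n0n n0m; case: (leqP n m) => [|/ltnW] nm; first exact: h.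
    by rewrite -opprB; apply: (lc_opp cW); exact: h.
  move=> n0n nm; have [l lP] := w_uniq _ _ nm _ (Ud n).
  pose i := maxn l (maxn (k n) (k m)).
  (* For [i] large, [v n - v m] is the sum of [w n (k n) - w n i], [w n i - w m i] and
     [w m i - w m (k m)]; they lie in [U n], [U n] and [U m] respectively. *)
  rewrite -[v n](subrK (w n i)) -[v n - w n i + _](subrK (w m i)) -(addrA (v n - _)) -addrA.
  have UnW' := UW' _ n0n; have UmW' := UW' _ (leq_trans n0n nm).
  by apply: W'W; [apply/UnW'/kP|apply/UnW'/lP|apply/UmW'/kP]; rewrite ?leq_max ?leqnn ?orbT.
exists v => //; apply/null_d2 => m.
have vw : lc_null (d1 m) (fun n => v n - w m n).
  move=> W dW; have [W1 dW1 W1W] := lc_third dW.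
  have [W2 cW2 W21] := c1d dW1; have [n0 UW2] := Uc cW2.
  have [n1 n1P] := (wP m).1 _ dW1.
  exists (maxn m (maxn n0 n1)) => n; rewrite !geq_max => /and3P[mn n0n n1n].
  have [l lP] := w_uniq _ _ mn _ dW1.
  pose i := maxn n (maxn l (k n)).
  rewrite -[v n](subrK (w n i)) -[v n - w n i + _](subrK (w m i)) -(addrA (v n - _)) -addrA.
  rewrite -(opprB (w m i)).
  apply: W1W; [apply/W21/(UW2 _ n0n)/kP|apply: (lc_opp dW1); apply: lP|apply: n1P];
    rewrite ?leq_max ?leqnn ?orbT //.
  by rewrite n1n.
apply: lc_null_ext (lc_nullD (lc_cont_null (@fd m) vw) (wP m).2) => n /=.
by rewrite linearB addrA subrK.
Qed.

End SequentialExactness.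

(** * Completed tensor products as classes of Cauchy sequences *)

Section SpanMap.
Context (K : nzRingType) (V W : lmodType K) (f : {linear V -> W}).

Lemma lspan_map (S : set V) (N : submodClosed W) :
  (forall s, S s -> f s \in N) -> forall x, x \in lspan S -> f x \in N.
Proof.
move=> SN x /asboolP Sx; pose P : {pred V} := fun y => f y \in N.
have PE y : (y \in P) = (f y \in N) by [].
have PP : submod_closed P.
  split; first by rewrite PE linear0 rpred0.
  by move=> a y z; rewrite !PE => Py Pz; rewrite linearP rpredD ?rpredZ.
pose M := GRing.isSubmodClosed.Build K V P PP.
pose MP : submodClosed V := HB.pack P M.
by rewrite -PE; apply: (Sx MP).
Qed.

Lemma lspan_eq0 (S : set V) :
  (forall s, S s -> f s = 0) -> forall x, x \in lspan S -> f x = 0.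
Proof.
pose P : {pred W} := fun y => y == 0.
have PP : submod_closed P.
  by split=> [|a y z /eqP -> /eqP ->]; rewrite /P /in_mem /= ?scaler0 ?addr0.
pose M := GRing.isSubmodClosed.Build K W P PP.
pose MP : submodClosed W := HB.pack P M.
move=> S0 x Sx; apply/eqP; apply: (@lspan_map _ MP) Sx => s /S0 fs.
exact/eqP.
Qed.

End SpanMap.

Section TensorLift.
Context (K : nzRingType) (Y X Z : lmodType K) (h : Y -> X -> Z).
Hypothesis h_linearl : forall x, linear (h^~ x).
Hypothesis h_linearr : forall y, linear (h y).

Let free_lift (D : free_mod Y X) : Z := fglift (fun z => h z.1 z.2) D.

HB.instance Definition _ := GRing.isLinear.Build K (free_mod Y X) Z *:%R
  free_lift (fglift_linear _).

Let free_liftE y x : free_lift (free_gen y x) = h y x.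
Proof. by rewrite [LHS]liftU scale1r. Qed.

Let free_lift_rel D : D \in lspan (@tensor_rel K Y X) -> free_lift D = 0.
Proof.
apply: lspan_eq0 => _ [a y y' x|a y x x']; rewrite linearB linearP /= !free_liftE.
  by rewrite h_linearl subrr.
by rewrite h_linearr subrr.
Qed.

Let lift (t : tensor Y X) : Z := free_lift (lquot_repr t).

Let lift_pi D : lift (tensor_pi D) = free_lift D.
Proof.
apply/eqP; rewrite eq_sym -subr_eq0 -linearB; apply/eqP/free_lift_rel.
exact: lquot_reprP.
Qed.

Let lift_linear : linear lift.
Proof.
move=> a; elim/lquot_ind=> x; elim/lquot_ind=> y.
by rewrite -linearP !lift_pi linearP.
Qed.

HB.instance Definition _ := GRing.isLinear.Build K (tensor Y X) Z *:%R
  lift lift_linear.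

(** Universal property of the algebraic tensor product. *)
Lemma tensor_lift : exists T : {linear tensor Y X -> Z}, forall y x, T (tens y x) = h y x.
Proof. by exists lift => y x; rewrite [LHS]lift_pi free_liftE. Qed.

End TensorLift.

Lemma tensor_linear_eq (K : nzRingType) (Y X Z : lmodType K) (F G : {linear tensor Y X -> Z}) :
  (forall y x, F (tens y x) = G (tens y x)) -> F =1 G.
Proof.
move=> FG t; have [s ->] := tensor_sum t; rewrite !linear_sum.
by apply: eq_bigr => i _; rewrite !linearZ /= FG.
Qed.

(** * The tensor product over [A] through sequences of algebraic tensors *)

Section AlgebraicQuotient.
Context (K : numFieldType) (A : banachAlgebra K) (Y X : tvsType K).
Context (rho : right_action A Y) (lam : left_action A X).

Definition alg_balancing : set (tensor Y X) :=
  [set t | exists y a x, t = tens (ract rho y a) x - tens y (lact lam a x)].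

(** Only the algebraic span of the relations is used: taking the closure is left to the topology.
    For Frechet modules, [tensorA_class0] and [tensor_lift_cauchy] identify the Hausdorff completion
    for this base with [tensorA]. *)
Definition tensor_base : lcBase (tensor Y X) :=
  lc_mod (proj_base Y X) (lspan alg_balancing).

End AlgebraicQuotient.

Section TensorBaseMap.
Context (K : numFieldType) (A : banachAlgebra K) (Y1 Y2 X : tvsType K).
Context (rho1 : right_action A Y1) (rho2 : right_action A Y2) (lam : left_action A X).
Context (f : {linear Y1 -> Y2}) (fc : continuous f).
Hypothesis f_act : forall y a, f (ract rho1 y a) = ract rho2 (f y) a.

Lemma tensor_base_cont :
  lc_cont (tensor_base rho1 lam) (tensor_base rho2 lam) (tensor_map X f).
Proof.
move=> _ [U bU ->]; have [Z bZ ZU] := tensor_map_cont fc bU.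
eexists; first by exists Z.
move=> t [m mN Zm]; exists (tensor_map X f m); last by rewrite -linearB; exact: ZU.
apply: lspan_map mN => _ [y [a [x ->]]]; apply: lspan_gen.
by exists (f y), a, x; rewrite linearB /= !tensor_mapE f_act.
Qed.

End TensorBaseMap.

Section Classes.
Context (K : numFieldType) (A : banachAlgebra K).
Context (Y : rightFrechetMod A) (X : leftFrechetMod A).
Local Notation b := (proj_base Y X).
Local Notation c := (tensor_base (rfm_act Y) (lfm_act X)).

Definition tensorA_class (v : cseq b) : tensorA Y X :=
  lquot_pi (closed_span (@balancing _ _ Y X)) (lquot_pi (@null_seq _ _ b) v).

Fact tensorA_class_linear : linear tensorA_class.
Proof. by move=> a u v; rewrite /tensorA_class !linearP. Qed.

HB.instance Definition _ := GRing.isLinear.Build K (cseq b) (tensorA Y X) *:%R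
  tensorA_class tensorA_class_linear.

Lemma tensorA_class_ind (t : tensorA Y X) : exists v, t = tensorA_class v.
Proof. by elim/lquot_ind: t; elim/lquot_ind => v; exists v. Qed.

(** Classes all of whose representatives are null for [c] form a closed subspace containing the
    balancing relations, hence their closed span. Conversely, if [v] is null for [c], its late terms
    are approximated by elements of the algebraic span, so its class lies in the closed span. *)
Lemma tensorA_class0 v : tensorA_class v = 0 <-> lc_null c v.
Proof.
have bc : lc_cont b c idfun by exact: lc_mod_coarser.
rewrite -[0](linear0 (lquot_pi (closed_span (@balancing _ _ Y X)))).
rewrite lquot_piP subr0; split=> [/asboolP vN|vN].
  pose P : {pred ctensor Y X} := fun t =>
    `[< forall u : cseq b, t = lquot_pi (@null_seq _ _ b) u -> lc_null c u >].
  have PE t : (t \in P) = `[< forall u : cseq b,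
    t = lquot_pi (@null_seq _ _ b) u -> lc_null c u >] by [].
  have null_c (u : cseq b) : u \in @null_seq _ _ b -> lc_null c u.
    move=> /asboolP nu; exact: (lc_cont_null (f := idfun) bc).
  have PP : submod_closed P.
    split.
      rewrite PE; apply/asboolP => u.
      by rewrite -(linear0 (lquot_pi _)) => /esym/lquot_piP; rewrite subr0; exact: null_c.
    move=> a x y; rewrite !PE; elim/lquot_ind: x => x; elim/lquot_ind: y => y.
    move=> /asboolP Px /asboolP Py; apply/asboolP => u.
    rewrite -linearP => /esym/lquot_piP/null_c h.
    have := lc_nullD h (lc_nullP a (Px _ erefl) (Py _ erefl)).
    by apply: lc_null_ext => n /=; rewrite subrK.
  pose M := GRing.isSubmodClosed.Build K (ctensor Y X) P PP.
  pose MP : submodClosed (ctensor Y X) := HB.pack P M.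
  suff /asboolP : lquot_pi (@null_seq _ _ b) v \in P by apply.
  apply: (vN MP) => [|_ [y [a [x ->]]]].
    (* Closedness: a representative [u'] of an adherent point is compared with an element [v'] of
       [P] close to it; up to terms small for the projective topology, [u' n] is [v' n], which is
       small for [c]. *)
    move=> x; elim/lquot_ind: x => u clu; rewrite /= -[_ \in _]/(_ \in P) PE.
    apply/asboolP => u' uu'; rewrite uu' in clu.
    move=> U cU; have [W cW WU] := lc_third cU.
    have [S bS WE] := cW.
    have SW x : S x -> W x by rewrite WE => ?; exists 0; rewrite ?rpred0// subr0.
    have [|t [tP [d Sd]]] := clu
        [set t | completion_set S (t - lquot_pi (@null_seq _ _ b) u')].
      by exists (completion_set S); [exists S|].
    move: tP; rewrite /= -[_ \in _]/(_ \in P) PE; elim/lquot_ind: t => v' /asboolP.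
    move=> /(_ _ erefl _ cW) [n1 v'W].
    rewrite -linearB => /completion_eqP/(_ _ bS)[n2 h].
    exists (maxn n1 n2) => n; rewrite geq_max => /andP[n1n n2n].
    rewrite (_ : u' n = v' n + - d n + - ((v' - u') n - d n)); last first.
      by rewrite cseqB !opprB !addrA subrK addrAC subrr add0r.
    apply: WU; first exact: v'W.
      by apply: (lc_opp cW); exact/SW.
    by apply: (lc_opp cW); apply/SW/h.
  rewrite -[_ \in _]/(_ \in P) PE; apply/asboolP => u.
  rewrite /ctens -linearB => /esym/completion_eqP.
  move/(lc_cont_null (f := idfun) bc) => h.
  apply: lc_null_ext (lc_nullD h _) => [n|]; first exact: subrK.
  by apply: lc_null_mod => n; apply: lspan_gen; exists y, a, x.
apply: closed_span_closed => B [_ [S bS ->] SB].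
have [T bT TS] := lc_half bS.
have [|n0 h0] := vN [set x |
    exists2 m, m \in lspan (alg_balancing (rfm_act Y) (lfm_act X)) & T (x - m)].
  by exists T.
have [n1 h1] := cseqP v bT; pose k := maxn n0 n1.
(* A single element [m] of the span, close to the late term [v k], is close to the whole tail of
   [v]. *)
have [|m mN Tm] := h0 k; first exact: leq_maxl.
exists (to_completion b m); split; last first.
  apply: SB; suff : completion_set S
      (lquot_pi (@null_seq _ _ b) (CSeq (cst_cauchy b m)) - lquot_pi (@null_seq _ _ b) v) by [].
  rewrite -linearB; apply: (completion_set_eventually (n0 := k)) => n kn.
  rewrite cseqB /= -(subrK (v k) m) -addrA; apply: TS.
    by rewrite -opprB; exact: (lc_opp bT).
  by apply: h1; rewrite ?(leq_trans _ kn) ?leq_maxr.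
have := @lspan_map _ _ (ctensor Y X) (to_completion b) _ (closed_span (@balancing _ _ Y X)).
move=> /(_ _ _ _ mN); apply=> _ [y [a [x ->]]].
by apply: closed_span_gen; exists y, a, x; rewrite linearB.
Qed.

Lemma proj_base_countable : lc_countable b.
Proof.
have [_ [BY [BY0 YB]] _] := rfm_frechet Y.
have [_ [BX [BX0 XB]] _] := lfm_frechet X.
(* Enumeration of pairs; numbers that code no pair are sent to [(0, 0)], a harmless repetition. *)
pose ij n := odflt (0%N, 0%N) (unpickle n).
apply: (@lc_countableW _ _ _ (fun n => proj_set (BY (ij n).1) (BX (ij n).2))) => [n|].
  by exists (BY (ij n).1), (BX (ij n).2).
move=> U [U1 [U2 [U10 U20 ->]]].
have [i iU] := YB _ U10; have [j jU] := XB _ U20; exists (pickle (i, j)).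
rewrite /ij pickleK /= => t [s [sU s1 ->]]; exists s; split=> // z /sU[? ?].
by split; [exact: iU|exact: jU].
Qed.

(** A sequence that is Cauchy only modulo the relations does not directly define an element of
    [tensorA]; the Mittag-Leffler correction replaces it by one that does. *)
Lemma tensor_lift_cauchy u : lc_cauchy c u ->
  exists v : cseq b, lc_null c (fun n => u n - v n).
Proof.
move=> /(lc_cauchy_lift proj_base_countable)[v cv uv].
by have [v' vv'] := cseq_of cv; exists v'; rewrite -vv'.
Qed.

End Classes.

(** * Translation between exactness of tensor products over [A] and sequential exactness *)

Section ShortExact.
Context (K : numFieldType) (A : banachAlgebra K).
Context (Y1 Y2 Y3 : rightFrechetMod A) (X : leftFrechetMod A).
Context (f : rmod_hom Y1 Y2) (g : rmod_hom Y2 Y3).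
Local Notation c Y := (tensor_base (rfm_act Y) (lfm_act X)).
Local Notation seq_ex :=
  (seq_exact (tensor_map X f) (tensor_map X g) (c Y1) (c Y2) (c Y3)).

Lemma tensorA_map_class (Z1 Z2 : rightFrechetMod A) (h : rmod_hom Z1 Z2)
    (v : cseq (proj_base Z1 X)) :
  (tensorA_map h X : {linear tensorA Z1 X -> tensorA Z2 X}) (tensorA_class v) =
  tensorA_class (cseq_map (tensor_map_cont (@rhom_continuous _ _ _ _ h)) v).
Proof.
rewrite [LHS](lquot_mapE (@tensorA_map_closed_span _ _ _ _ h X)).
by congr lquot_pi; exact: lquot_mapE (@cseq_map_null _ _ _ _ _ _ _) _.
Qed.

Lemma rmod_hom_tensor_cont (Z1 Z2 : rightFrechetMod A) (h : rmod_hom Z1 Z2) :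
  lc_cont (c Z1) (c Z2) (tensor_map X h).
Proof. exact: tensor_base_cont (@rhom_continuous _ _ _ _ h) (@rhom_act _ _ _ _ h). Qed.

Lemma short_exact_seq :
  short_exact (tensorA_map f X) (tensorA_map g X) -> seq_ex.
Proof.
have fc := rmod_hom_tensor_cont f; have gc := rmod_hom_tensor_cont g.
move=> [finj fg _]; split=> [u cu fu|u cu gu]; have [v uv] := tensor_lift_cauchy cu.
  suff v0 : lc_null (c Y1) v.
    by apply: lc_null_ext (lc_nullD uv v0) => n; rewrite subrK.
  apply/tensorA_class0/finj; rewrite tensorA_map_class linear0.
  apply/tensorA_class0.
  apply: lc_null_ext (lc_nullB fu (lc_cont_null fc uv)) => n /=.
  by rewrite linearB opprB addrC subrK.
have /fg[t] : tensorA_map g X (tensorA_class v) = 0.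
  rewrite tensorA_map_class; apply/tensorA_class0.
  apply: lc_null_ext (lc_nullB gu (lc_cont_null gc uv)) => n /=.
  by rewrite linearB opprB addrC subrK.
have [w ->] := tensorA_class_ind t; rewrite tensorA_map_class => /eqP.
rewrite -subr_eq0 -linearB => /eqP/tensorA_class0 fw.
exists w.
  exact: (lc_cont_cauchy (f := idfun) (@lc_mod_coarser _ _ _ _) (@cseq_cauchy _ _ _ _)).
by apply: lc_null_trans fw _; exact: lc_nullC.
Qed.

(** Injectivity and exactness in the middle are the two halves of [seq_ex]. Surjectivity comes from
    the section [s], applied termwise to a representative; continuity of [s] for the projective
    topologies suffices, compatibility with the action is not asked for. *)
Lemma seq_short_exact :
  short_exact f g -> topologically_split f g -> seq_ex ->
  short_exact (tensorA_map f X) (tensorA_map g X).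
Proof.
move=> [_ fg0 _] [r [s [rc sc rf gs _]]] [einj emid].
have cauchy_c (Y : rightFrechetMod A) (v : cseq (proj_base Y X)) : lc_cauchy (c Y) v.
  exact: (lc_cont_cauchy (f := idfun) (@lc_mod_coarser _ _ _ _) (@cseq_cauchy _ _ _ _)).
split=> [t t'|t|t].
- have [v ->] := tensorA_class_ind t; have [v' ->] := tensorA_class_ind t'.
  move/eqP; rewrite -subr_eq0 -linearB -linearB tensorA_map_class => /eqP /tensorA_class0.
  move/(einj _ (@cauchy_c _ _))/tensorA_class0/eqP.
  by rewrite linearB subr_eq0 => /eqP.
- have [v ->] := tensorA_class_ind t; split.
    rewrite tensorA_map_class => /tensorA_class0 /(emid _ (@cauchy_c _ _))[w cw fw].
    have [w' ww'] := tensor_lift_cauchy cw; exists (tensorA_class w').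
    rewrite tensorA_map_class; apply/eqP; rewrite -subr_eq0 -linearB.
    apply/eqP/tensorA_class0.
    have := lc_nullB fw (lc_cont_null (rmod_hom_tensor_cont f) ww').
    by apply: lc_null_ext => n /=; rewrite linearB opprB addrC addrA subrK.
  move=> [u <-]; have [w ->] := tensorA_class_ind u.
  rewrite (tensorA_map_class f w) tensorA_map_class; apply/tensorA_class0.
  apply: lc_null_ext (@lc_null0 _ _ _) => n /=.
  rewrite -[LHS]/((\0 : {linear _ -> _}) (w n)) -[RHS]/((tensor_map X g \o tensor_map X f) (w n)).
  apply: tensor_linear_eq => y x /=; rewrite !tensor_mapE (_ : g (f y) = 0).
    by rewrite -(scale0r (0 : Y3)) tensZl scale0r.
  by apply/fg0; exists y.
- have [v ->] := tensorA_class_ind t.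
  exists (tensorA_class (cseq_map (tensor_map_cont sc) v)).
  rewrite tensorA_map_class; congr tensorA_class; apply/val_inj/funext => n /=.
  rewrite -[LHS]/((tensor_map X g \o tensor_map X s) (v n)) -[RHS]/(idfun (v n)).
  by apply: tensor_linear_eq => y x /=; rewrite !tensor_mapE gs.
Qed.

End ShortExact.

(** * Gauges and completion to a Banach space *)

Section Disc.
Context (K : numFieldType) (V : lmodType K).

Record disc (D : set V) : Prop := Disc {
  disc_absconvex : forall x y (a b : K), D x -> D y -> `|a| + `|b| <= 1 ->
    D (a *: x + b *: y);
  disc_absorbing : forall x, exists2 e : K, e != 0 & D (e *: x)
}.

Context (D : set V) (hD : disc D).

Lemma disc_balanced x a : D x -> `|a| <= 1 -> D (a *: x).
Proof.
move=> Dx a1; have := disc_absconvex hD (b := 0) Dx Dx.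
by move=> /(_ a); rewrite scale0r addr0 normr0 addr0; apply.
Qed.

Lemma disc_le x (a b : K) : `|a| <= `|b| -> D (b *: x) -> D (a *: x).
Proof.
have [->|b0] := eqVneq b 0.
  by rewrite normr0 normr_le0 => /eqP ->.
move=> ab Dx; rewrite -[a](divfK b0) -scalerA; apply: disc_balanced => //.
by rewrite normrM normfV ler_pdivrMr ?mul1r ?normr_gt0.
Qed.

Lemma disc_half x y : D (2 *: x) -> D (2 *: y) -> D (x + y).
Proof.
move=> Dx Dy; have := disc_absconvex hD (a := 2^-1) (b := 2^-1) Dx Dy.
rewrite !scalerA mulVf ?pnatr_eq0// !scale1r; apply.
by rewrite ger0_norm ?invr_ge0 ?ler0n// [leRHS]splitr mul1r.
Qed.

(** The nonzero multiples of [D], a base for the topology of its gauge seminorm. *)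
Definition disc_sets (S : set V) : Prop :=
  exists2 e : K, e != 0 & S = [set x | D (e *: x)].

Fact disc_ex : exists S, disc_sets S.
Proof. by eexists; exists 1; rewrite ?oner_neq0. Qed.

Fact disc_setI S T : disc_sets S -> disc_sets T ->
  exists2 Z, disc_sets Z & Z `<=` S `&` T.
Proof.
move=> [e e0 ->] [d d0 ->]; exists [set x | D ((`|e| + `|d|) *: x)].
  by exists (`|e| + `|d|); rewrite // gt_eqF// ltr_wpDl// normr_gt0.
move=> x /= h; split; apply: disc_le h.
  by rewrite (ger0_norm (_ : 0 <= `|e| + _)) ?addr_ge0// lerDl.
by rewrite (ger0_norm (_ : 0 <= `|e| + _)) ?addr_ge0// lerDr.
Qed.

Fact disc_sets_absconvex S x y (a b : K) : disc_sets S -> S x -> S y ->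
  `|a| + `|b| <= 1 -> S (a *: x + b *: y).
Proof.
move=> [e e0 ->] /= Dx Dy ab; rewrite scalerDr !scalerA !(mulrC e) -!scalerA.
exact: disc_absconvex.
Qed.

Fact disc_sets_absorbing S x : disc_sets S -> exists2 e : K, e != 0 & S (e *: x).
Proof.
move=> [e e0 ->]; have [d d0 Dx] := disc_absorbing hD (e *: x).
by exists d; rewrite //= scalerA mulrC -scalerA.
Qed.

Fact disc_homothety S (a : K) : disc_sets S ->
  exists2 T, disc_sets T & forall x, T x -> S (a *: x).
Proof.
move=> [e e0 ->]; have d0 : 0 < 1 + `|a| by rewrite ltr_wpDr.
exists [set x | D ((e * (1 + `|a|)) *: x)].
  by exists (e * (1 + `|a|)); rewrite ?mulf_neq0// gt_eqF.
move=> x /= h; rewrite scalerA; apply: disc_le h.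
by rewrite !normrM (gtr0_norm d0) ler_wpM2l// lerDr.
Qed.

Definition disc_base : lcBase V := LcBase
  disc_ex disc_setI disc_sets_absconvex disc_sets_absorbing disc_homothety.

Lemma disc_base_unit : disc_base D.
Proof. by exists 1; rewrite ?oner_neq0//; apply/seteqP; split=> x /=; rewrite scale1r. Qed.

End Disc.

(** Induction from two-term combinations: the tail of total weight [m] is [m] times a combination of
    weight 1. If [m = 0], all coefficients of the tail vanish. *)
Lemma disc_sum (K : numFieldType) (V : lmodType K) (D : set V) (T : eqType)
    (s : seq T) (a : T -> K) (x : T -> V) : disc D ->
  (forall i, i \in s -> D (x i)) -> \sum_(i <- s) `|a i| <= 1 ->
  D (\sum_(i <- s) a i *: x i).
Proof.
move=> hD; have [e e0 De] := disc_absorbing hD 0.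
elim: s a => [|i s IH] a Dx; first by rewrite !big_nil -(scaler0 _ e).
have Ds j : j \in s -> D (x j) by move=> js; apply: Dx; rewrite inE js orbT.
have Di : D (x i) by apply: Dx; rewrite inE eqxx.
rewrite !big_cons; set m := \sum_(_ <- _) _.
have m_ge0 : 0 <= m by exact: sumr_ge0.
have [m0|m0] := eqVneq m 0.
  move=> a1; rewrite [X in _ + X]big_seq [X in _ + X]big1 ?addr0.
    by apply: disc_balanced => //; rewrite m0 addr0 in a1.
  move=> j js; move/eqP: m0; rewrite psumr_eq0// => /allP/(_ j js).
  by rewrite normr_eq0 => /eqP ->; rewrite scale0r.
move=> am; rewrite (_ : \sum_(j <- s) _ = m *: \sum_(j <- s) (m^-1 * a j) *: x j).
  apply: (disc_absconvex hD) => //; last by rewrite (ger0_norm m_ge0).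
  apply: IH => //; under eq_bigr do rewrite normrM.
  by rewrite -mulr_sumr ger0_norm ?invr_ge0// mulVf.
by rewrite scaler_sumr; apply: eq_bigr => j _; rewrite scalerA mulrA mulfV// mul1r.
Qed.

Lemma lc_disc (K : numFieldType) (V : lmodType K) (b : lcBase V) U : b U -> disc U.
Proof.
move=> bU; split=> [x y a a' Ux Uy|x]; first exact: lc_absconvex bU _ _.
exact: lc_absorbing bU.
Qed.

Section ComplexPositive.
Context (R : realType).
Local Notation C := R[i].

Lemma complex_ge0 (t : C) : 0 <= t -> exists2 r : R, 0 <= r & t = r%:C%C.
Proof. by case: t => a b; rewrite lecE /= => /andP[/eqP -> a0]; exists a. Qed.

Lemma complex_gt0 (t : C) : 0 < t -> exists2 r : R, 0 < r & t = r%:C%C.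
Proof. by case: t => a b; rewrite ltcE /= => /andP[/eqP -> a0]; exists a. Qed.

Lemma complex_nat_bound (t : C) : exists n : nat, `|t| <= n%:R.
Proof.
have [r r0 ->] := complex_ge0 (normr_ge0 t); exists (Num.bound r).
rewrite -(rmorph_nat (real_complex R)) lecR.
exact/ltW/archi_boundP.
Qed.

End ComplexPositive.

(** * The Minkowski functional of a disc *)

Section Gauge.
Context (R : realType).
Local Notation C := R[i].
Context (V : lmodType C) (D : set V) (hD : disc D).

Definition gauge_set (x : V) : set R := [set t | 0 < t /\ D ((t%:C%C)^-1 *: x)].

(** Taken in [R], where infima exist; it is embedded into [C] when it serves as a norm. *)
Definition gauge (x : V) : R := inf (gauge_set x).

Let gauge_lb x : lbound (gauge_set x) 0.
Proof. by move=> t [/ltW]. Qed.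

Let gauge_has_inf x : has_inf (gauge_set x).
Proof.
split; last by exists 0; exact: gauge_lb.
have [e e0 De] := disc_absorbing hD x.
have /complex_gt0 [r r0 re] : 0 < `|e|^-1 by rewrite invr_gt0 normr_gt0.
exists r; split=> //; rewrite -re invrK.
by apply: disc_le De; rewrite ?normr_id.
Qed.

Lemma gauge_ge0 x : 0 <= gauge x.
Proof. by apply: lb_le_inf; [exact: (gauge_has_inf x).1|exact: gauge_lb]. Qed.

Lemma gauge_le x t : 0 < t -> D ((t%:C%C)^-1 *: x) -> gauge x <= t.
Proof. by move=> t0 Dx; apply: ge_inf => //; exists 0; exact: gauge_lb. Qed.

Lemma gauge_lt x t : gauge x < t -> D ((t%:C%C)^-1 *: x).
Proof.
move=> xt; have [s [s0 Ds] st] := inf_lt (gauge_has_inf x).1 xt.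
have t0 := lt_trans s0 st; apply: disc_le Ds => //.
rewrite !normfV !gtr0_norm ?ltcR// lef_pV2 ?posrE ?ltcR// lecR; exact: ltW.
Qed.

Lemma gaugeD x y : gauge (x + y) <= gauge x + gauge y.
Proof.
apply/ler_addgt0Pr => e e0; have e20 : 0 < e / 2 by rewrite divr_gt0.
have xt : gauge x < gauge x + e / 2 by rewrite ltrDl.
have yt : gauge y < gauge y + e / 2 by rewrite ltrDl.
have := gauge_lt xt; have := gauge_lt yt.
set s := gauge x + _ in xt *; set t := gauge y + _ in yt *; move=> Dy Dx.
have s0 : 0 < s by exact: le_lt_trans (gauge_ge0 _) xt.
have t0 : 0 < t by exact: le_lt_trans (gauge_ge0 _) yt.
rewrite (_ : _ + _ + e = s + t); last by rewrite /s /t addrACA -splitr.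
have st0 : 0 < s + t by rewrite addr_gt0.
apply: gauge_le => //; rewrite scalerDr.
have neq0 r : 0 < r -> (r%:C%C : C) != 0 by move=> r0; rewrite gt_eqF// ltcR.
rewrite -[x in D (_ *: x + _)](scalerKV (neq0 _ s0)).
rewrite -[y in D (_ + _ *: y)](scalerKV (neq0 _ t0)).
rewrite (scalerA _ (s%:C%C)) (scalerA _ (t%:C%C)).
apply: disc_absconvex => //.
rewrite !normrM !normfV !gtr0_norm ?ltcR// -mulrDr -rmorphD /=.
by rewrite mulVf// neq0.
Qed.

Lemma gaugeZ_le (l : C) x r : `|l| = r%:C%C -> l != 0 -> gauge (l *: x) <= r * gauge x.
Proof.
move=> lr l0; have r0 : 0 < r by rewrite -ltcR -lr normr_gt0.
apply/ler_addgt0Pr => e e0.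
have xt : gauge x < gauge x + r^-1 * e by rewrite ltrDl mulr_gt0 ?invr_gt0.
have t0 := le_lt_trans (gauge_ge0 _) xt.
rewrite (_ : _ + e = r * (gauge x + r^-1 * e)); last by rewrite mulrDr mulVKf ?gt_eqF.
apply: gauge_le; first by rewrite mulr_gt0.
rewrite scalerA; apply: disc_le (gauge_lt xt) => //.
have rC : 0 < r%:C%C :> C by rewrite ltcR.
rewrite rmorphM /= invfM mulrAC normrM [X in X * _]normrM lr normfV (gtr0_norm rC).
by rewrite mulVf ?mul1r ?gt_eqF.
Qed.

(** The reverse inequality is [gaugeZ_le] for [l^-1] at the vector [l *: x]. *)
Lemma gaugeZ (l : C) x : (gauge (l *: x))%:C%C = `|l| * (gauge x)%:C%C.
Proof.
have [r r0 lr] := complex_ge0 (normr_ge0 l).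
have [->|l0] := eqVneq l 0.
  rewrite scale0r normr0 mul0r; congr (_ %:C)%C; apply/eqP; rewrite eq_le gauge_ge0 andbT.
  apply/ler_addgt0Pr => e e0; rewrite add0r; apply: gauge_le => //.
  have [d d0] := disc_absorbing hD (0 : V); by rewrite !scaler0.
rewrite lr -rmorphM /=; congr (_ %:C)%C; apply/eqP; rewrite eq_le gaugeZ_le//=.
have lr' : `|l^-1| = (r^-1)%:C%C by rewrite normfV lr fmorphV.
have rp : 0 < r by rewrite -ltcR -lr normr_gt0.
have := gaugeZ_le (l *: x) lr' (invr_neq0 l0).
by rewrite scalerA mulVf// scale1r ler_pdivlMl.
Qed.

End Gauge.

(** * The Banach space obtained by completing for the gauge of a disc *)

Section BanachCompletion.
Context (R : realType).
Local Notation C := R[i].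
Context (V : lmodType C) (D : set V) (hD : disc D).
Local Notation b := (disc_base hD).

Definition bcompl_type : Type := completion b.

HB.instance Definition _ := GRing.Lmodule.copy bcompl_type (completion b).

Definition bcompl_pi (u : cseq b) : bcompl_type := lquot_pi (@null_seq _ _ b) u.

Fact bcompl_pi_linear : linear bcompl_pi.
Proof. exact: lquot_pi_linear. Qed.

HB.instance Definition _ := GRing.isLinear.Build C (cseq b) bcompl_type *:%R
  bcompl_pi bcompl_pi_linear.

Lemma bcompl_eqP u v : bcompl_pi u = bcompl_pi v <-> lc_null b (fun n => u n - v n).
Proof. exact: completion_eqP. Qed.

Lemma bcompl_ind (P : bcompl_type -> Prop) : (forall u, P (bcompl_pi u)) -> forall c, P c.
Proof. by move=> h; elim/lquot_ind. Qed.

Definition bhat : set bcompl_type := completion_set D.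

Lemma bhat_disc : disc bhat.
Proof.
suff : disc (completion_set D : set (completion b)) by [].
by apply: (@lc_disc _ _ (completion_base b)); exists D => //; exact: disc_base_unit.
Qed.

Lemma bhat_eventually (u : cseq b) (e : C) n0 :
  (forall n, (n0 <= n)%N -> D (e *: u n)) -> bhat (e *: bcompl_pi u).
Proof. by move=> h; rewrite -linearZ; exact: completion_set_eventually h. Qed.

(** The class determines its representative only up to a null sequence, whose late terms lie in [D];
    averaging the two contributions costs the factor 2. *)
Lemma bhat_null (u : cseq b) (e : C) : bhat (e *: bcompl_pi u) ->
  exists n0, forall n, (n0 <= n)%N -> D ((e / 2) *: u n).
Proof.
rewrite -linearZ => -[v Dv /completion_eqP/(_ _ (disc_base_unit hD))[n0 h]].
exists n0 => n /h Du; rewrite (_ : _ *: u n = 2^-1 *: v n + 2^-1 *: ((e *: u) n - v n)).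
  apply: (disc_absconvex hD) => //.
  by rewrite ger0_norm ?invr_ge0 ?ler0n// [leRHS]splitr mul1r.
by rewrite -scalerDr addrC subrK scalerA mulrC.
Qed.

Definition bcompl_norm (c : bcompl_type) : C := (gauge bhat c)%:C%C.

Fact bcompl_normD x y : bcompl_norm (x + y) <= bcompl_norm x + bcompl_norm y.
Proof. by rewrite /bcompl_norm -rmorphD lecR; exact: gaugeD bhat_disc _ _. Qed.

Fact bcompl_normZ (l : C) x : bcompl_norm (l *: x) = `|l| * bcompl_norm x.
Proof. exact: gaugeZ bhat_disc _ _. Qed.

Fact bcompl_norm0 x : bcompl_norm x = 0 -> x = 0.
Proof.
elim/bcompl_ind: x => u /eqP; rewrite /bcompl_norm -(rmorph0 (real_complex R)).
move=> /eqP/(congr1 (@complex.Re _)) /= u0.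
rewrite -(linear0 bcompl_pi); apply/bcompl_eqP => _ [e e0 ->].
have /complex_gt0 [r r0 re] : 0 < (2 * `|e|)^-1 by rewrite invr_gt0 mulr_gt0// normr_gt0.
have /(gauge_lt bhat_disc) : gauge bhat (bcompl_pi u) < r by rewrite u0.
rewrite -re invrK => /bhat_null[n0 h]; exists n0 => n /h.
have -> : u n - (0 : cseq b) n = u n by exact: subr0.
apply: (disc_le hD).
by rewrite mulrAC mulfV ?pnatr_eq0// mul1r normr_id.
Qed.

HB.instance Definition _ := Lmodule_isNormed.Build C bcompl_type
  bcompl_normD bcompl_normZ bcompl_norm0.

Lemma bcompl_norm_lt (x : bcompl_type) (t : C) : `|x| < t -> bhat (t^-1 *: x).
Proof.
move=> xt; have /complex_gt0[r r0 tr] : 0 < t by exact: le_lt_trans xt.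
by rewrite tr; apply: (gauge_lt bhat_disc); rewrite -ltcR -tr.
Qed.

Lemma bcompl_norm_le1 (x : bcompl_type) : bhat x -> `|x| <= 1.
Proof.
move=> Dx; suff : (gauge bhat x)%:C%C <= 1 :> C by [].
by rewrite -(rmorph1 (real_complex R)) lecR; apply: gauge_le; rewrite // rmorph1 invr1 scale1r.
Qed.

Lemma bcompl_norm_le (x : bcompl_type) (t : C) : 0 < t -> bhat (t^-1 *: x) -> `|x| <= t.
Proof.
move=> t0 /bcompl_norm_le1; rewrite normrZ normfV gtr0_norm//.
by rewrite ler_pdivrMl// mulr1.
Qed.

Lemma bhat_nbhs : nbhs (0 : bcompl_type) bhat.
Proof.
rewrite -nbhs_ballE; exists 1 => //= x; rewrite -ball_normE /= sub0r normrN.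
by move/bcompl_norm_lt; rewrite invr1 scale1r.
Qed.

Lemma nbhs_bhat (U : set bcompl_type) : nbhs 0 U ->
  exists2 e : C, 0 < e & forall x, bhat (e *: x) -> U x.
Proof.
rewrite -nbhs_ballE => -[r /= r0 rU]; exists (2 / r); first by rewrite divr_gt0.
move=> x h; apply: rU; rewrite -ball_normE /= sub0r normrN.
have r20 : 0 < r / 2 by rewrite divr_gt0.
rewrite (@le_lt_trans _ _ (r / 2))//; last by rewrite ltr_pdivrMr// ltr_pMr// ltr1n.
by apply: bcompl_norm_le => //; rewrite invfM invrK mulrC.
Qed.

Definition bcompl_inj (x : V) : bcompl_type := to_completion b x.

Fact bcompl_inj_linear : linear bcompl_inj.
Proof. exact: to_completion_linear. Qed.

HB.instance Definition _ := GRing.isLinear.Build C V bcompl_type *:%R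
  bcompl_inj bcompl_inj_linear.

Lemma bhat_inj x : D x -> bhat (bcompl_inj x).
Proof.
move=> Dx; rewrite -[bcompl_inj x]scale1r; apply: (bhat_eventually (n0 := 0%N)) => n _.
by rewrite scale1r.
Qed.

Lemma bhat_injV x : bhat (bcompl_inj x) -> D (2^-1 *: x).
Proof.
rewrite -[bcompl_inj x]scale1r => /bhat_null[n0 /(_ n0 (leqnn _))].
by rewrite mul1r.
Qed.

Lemma bcompl_dense (c : bcompl_type) (e : C) : e != 0 ->
  exists x, bhat (e *: (c - bcompl_inj x)).
Proof.
move=> e0; elim/bcompl_ind: c => u.
have [|n0 h] := cseqP u (_ : b [set x | D (e *: x)]); first by exists e.
exists (u n0); rewrite -linearB; apply: (bhat_eventually (n0 := n0)) => n n0n.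
exact: h.
Qed.

(** By density, for each [n] some point of [V] is the centre of a ball of radius [n.+1%:R^-1]
    belonging to [F]. These centres form a Cauchy sequence of [V], and its class is the limit. *)
Fact bcompl_complete (F : set_system bcompl_type) : ProperFilter F -> cauchy F -> cvg F.
Proof.
move=> PF /cauchyP Fc.
have approx n : exists x : V, F (ball (bcompl_inj x) n.+1%:R^-1).
  have n0 : (0 : C) < n.+1%:R^-1 / 2 by rewrite divr_gt0// invr_gt0 ltr0n.
  have [c Fball] := Fc _ n0.
  have [|x Dx] := @bcompl_dense c (n.+1%:R^-1 / 4)^-1.
    by rewrite invr_eq0 mulf_neq0// ?invr_eq0 ?pnatr_eq0.
  exists x; apply: filterS Fball => y cy; apply: (ball_splitr (z := c)) => //=.
  rewrite -ball_normE /=.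
  rewrite (@le_lt_trans _ _ (n.+1%:R^-1 / 4))//.
    by apply: bcompl_norm_le; rewrite // divr_gt0// invr_gt0 ltr0n.
  by rewrite ltr_pM2l ?invr_gt0 ?ltr0n// ltf_pV2 ?posrE// ltr_nat.
have [u uP] := choice approx.
have natV k n : (k <= n)%N -> n.+1%:R^-1 <= k.+1%:R^-1 :> C.
  by move=> kn; rewrite lef_pV2 ?posrE ?ltr0n// ler_nat.
have cu : lc_cauchy b u.
  (* Two centres are at distance less than twice the radius, and [bhat_injV] loses another factor 2:
     hence the 4. *)
  move=> _ [e e0 ->]; have [k ke] := complex_nat_bound (4 * e).
  exists k => m n km kn; have [y [ym yn]] := @filter_ex _ _ PF _ (filterI (uP m) (uP n)).
  have : ball (bcompl_inj (u m)) (k.+1%:R^-1 + k.+1%:R^-1) (bcompl_inj (u n)).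
    apply: (@ball_triangle _ _ y); first exact: le_ball (natV _ _ km) _ ym.
    by apply: ball_sym; exact: le_ball (natV _ _ kn) _ yn.
  rewrite -ball_normE /= -linearB => /bcompl_norm_lt.
  rewrite -linearZ => /bhat_injV /=; rewrite scalerA; apply: (disc_le hD).
  rewrite -mulr2n -[_^-1 *+ 2]mulr_natl -invfM mulrA -natrM normfV normrM normfV !normr_nat.
  rewrite invfM invrK ler_pdivlMl ?ltr0n// -[X in X * _]normr_nat -normrM.
  by rewrite (le_trans ke)// ler_nat.
have [v uv] := cseq_of cu.
apply/cvg_ex; exists (bcompl_pi v); apply/fcvg_ballP => e e0.
have [k ke] := complex_nat_bound (2 / e).
have [|n0 h] := cu [set x | D ((4 / e) *: x)].
  by exists (4 / e); rewrite // gt_eqF// divr_gt0.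
pose n := maxn n0 k; apply: filterS (uP n) => y ny.
have e20 : 0 < e / 2 by rewrite divr_gt0.
apply: (ball_split (z := bcompl_inj (u n))).
  rewrite -ball_normE /= (@le_lt_trans _ _ (e / 4))//; last first.
    by rewrite ltr_pM2l// ltf_pV2 ?posrE ?ltr0n// ltr_nat.
  apply: bcompl_norm_le; first by rewrite divr_gt0.
  rewrite invfM invrK mulrC -linearB; apply: (bhat_eventually (n0 := n0)) => m n0m.
  by rewrite cseqB -uv; apply: h => //; rewrite leq_maxl.
apply: le_ball ny; rewrite (le_trans (natV k n _)) ?leq_maxr//.
rewrite -[leRHS]invrK lef_pV2 ?posrE ?invr_gt0// invfM invrK mulrC.
rewrite -[leLHS]gtr0_norm ?divr_gt0// (le_trans ke)// ler_nat.
exact: leqnSn.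
Qed.

HB.instance Definition _ := Uniform_isComplete.Build bcompl_type bcompl_complete.

End BanachCompletion.

Definition bcompl (R : realType) (V : lmodType R[i]) (D : set V) (hD : disc D) :
  completeNormedModType R[i] := bcompl_type hD.

(** * Completion of modules *)

Section LinearFun.
Context (K : pzRingType) (U V : lmodType K) (f : U -> V).
Hypothesis fl : linear f.

HB.instance Definition _ := GRing.isLinear.Build K U V *:%R f fl.

(** For maps such as [ract^~ a], whose linearity is a proof and not an instance. *)
Lemma linear_fun_scale a x : f (a *: x) = a *: f x.
Proof. exact: linearZ. Qed.

Lemma linear_fun_add x y : f (x + y) = f x + f y.
Proof. exact: linearD. Qed.

Lemma linear_fun_sub x y : f (x - y) = f x - f y.
Proof. exact: linearB. Qed.

End LinearFun.

Lemma linear_continuous0 (K : numFieldType) (E F : tvsType K) (f : {linear E -> F}) :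
  (forall U, nbhs 0 U -> nbhs 0 (f @^-1` U)) -> continuous f.
Proof.
move=> f0 x U Ux.
have /f0 : nbhs 0 [set y | U (f x + y)].
  have := nbhsB (- f x) Ux; rewrite addNr; apply: filterS => _ [y Uy <-] /=.
  by rewrite addrA subrr add0r.
move/(nbhsT x); apply: filterS => _ [y Uy <-] /=.
by rewrite linearD.
Qed.

Lemma nbhs0_scale (K : numFieldType) (E : tvsType K) (U : set E) (e : K) :
  e != 0 -> nbhs 0 U -> nbhs 0 [set x | U (e *: x)].
Proof.
move=> e0 U0; have := nbhs0Z (invr_neq0 e0) U0; apply: filterS => _ [x Ux <-] /=.
by rewrite scalerA mulfV// scale1r.
Qed.

Section BanachMap.
Context (R : realType).
Local Notation C := R[i].
Context (V W : lmodType C) (D : set V) (E : set W) (hD : disc D) (hE : disc E).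
Context (f : {linear V -> W}) (k : C).
Hypothesis k0 : k != 0.
Hypothesis fDE : forall x, D x -> E (k *: f x).

(** The hypothesis [fDE] says that [f] has norm at most the inverse of the modulus of [k] for the
    two gauges. *)
Fact disc_cont : lc_cont (disc_base hD) (disc_base hE) f.
Proof.
move=> _ [e e0 ->]; exists [set x | D ((e / k) *: x)].
  by exists (e / k); rewrite ?mulf_neq0 ?invr_eq0.
by move=> x /fDE; rewrite linearZ /= scalerA mulrCA mulfV// mulr1.
Qed.

Definition bmap : bcompl hD -> bcompl hE := completion_map disc_cont.

Fact bmap_linear : linear bmap.
Proof. exact: completion_map_linear. Qed.

HB.instance Definition _ := GRing.isLinear.Build C (bcompl hD) (bcompl hE) *:%R
  bmap bmap_linear.

Lemma bmap_pi u : bmap (bcompl_pi u) = bcompl_pi (cseq_map disc_cont u).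
Proof. exact: (lquot_mapE (@cseq_map_null _ _ _ _ _ _ disc_cont)). Qed.

Lemma bmap_inj x : bmap (bcompl_inj hD x) = bcompl_inj hE (f x).
Proof. exact: completion_map_to. Qed.

Lemma bmap_bhat c : bhat c -> bhat (k *: bmap c).
Proof.
case=> u Du ->; rewrite [bmap _]bmap_pi; apply: (bhat_eventually (n0 := 0%N)) => n _.
exact: fDE.
Qed.

Lemma bmap_continuous : continuous bmap.
Proof.
apply: linear_continuous0 => U /nbhs_bhat[e e0 eU].
have ek : e / k != 0 by rewrite mulf_neq0 ?invr_eq0// gt_eqF.
have := nbhs0_scale ek (bhat_nbhs hD); apply: filterS => c /= /bmap_bhat.
by rewrite linearZ /= scalerA mulrCA mulfV// mulr1 => /eU.
Qed.

End BanachMap.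
Arguments disc_cont {R V W D E} hD hE {f k}.
Arguments bmap {R V W D E} hD hE {f k}.

(** * The action of [A] on the completion *)

Section BanachModule.
Context (R : realType).
Local Notation C := R[i].
Context (A : banachAlgebra C) (Y : tvsType C) (rho : right_action A Y).
Context (D : set Y) (hD : disc D) (k : C).
Hypothesis k0 : k != 0.
Hypothesis DA : forall y (a : A), D y -> `|a| <= 1 -> D (k *: ract rho y a).

Definition ractr (a : A) (y : Y) : Y := ract rho y a.

HB.instance Definition _ a := GRing.isLinear.Build C Y Y *:%R (ractr a)
  (ract_linearl rho a).

Lemma ractZ y (t : C) a : ract rho y (t *: a) = t *: ract rho y a.
Proof. exact: (linear_fun_scale (ract_linearr rho y)). Qed.

Let norm1 (a : A) : (0 : C) < 1 + `|a|. Proof. by rewrite ltr_wpDr. Qed.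

(** Dividing by 1 plus the norm of [a] brings [a] into the unit ball and makes sense for [a = 0]
    too. *)
Fact ractr_disc a y : D y -> D ((k / (1 + `|a|)) *: ractr a y).
Proof.
move=> Dy; rewrite -scalerA -ractZ; apply: DA => //.
by rewrite normrZ normfV (gtr0_norm (norm1 a)) ler_pdivrMl// mulr1 lerDr.
Qed.

Let ka0 (a : A) : k / (1 + `|a|) != 0.
Proof. by apply: mulf_neq0 => //; rewrite invr_eq0 gt_eqF. Qed.

Definition bact (c : bcompl hD) (a : A) : bcompl hD :=
  bmap hD hD (ka0 a) (@ractr_disc a) c.

Lemma bact_pi u a : bact (bcompl_pi u) a =
  bcompl_pi (cseq_map (disc_cont hD hD (ka0 a) (@ractr_disc a)) u).
Proof. exact: bmap_pi. Qed.

Lemma bact_inj y a : bact (bcompl_inj hD y) a = bcompl_inj hD (ract rho y a).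
Proof. exact: bmap_inj. Qed.

Fact bact_linearl a : linear (bact^~ a).
Proof. exact: bmap_linear. Qed.

Fact bact_linearr c : linear (bact c).
Proof.
move=> t a a'; elim/bcompl_ind: c => u; rewrite !bact_pi -linearP.
by congr bcompl_pi; apply/val_inj/funext => n; exact: ract_linearr.
Qed.

Fact bactA c a a' : bact (bact c a) a' = bact c (ba_mul a a').
Proof.
elim/bcompl_ind: c => u; rewrite !bact_pi.
by congr bcompl_pi; apply/val_inj/funext => n; exact: ractA.
Qed.

Lemma bact_bhat c a (s t : C) : bhat (s *: c) -> `|t *: a| <= 1 ->
  bhat ((k * s * t) *: bact c a).
Proof.
move=> sc ta.
have -> : (k * s * t) *: bact c a = k *: bact (s *: c) (t *: a).
  rewrite (linear_fun_scale (bact_linearl _)) (linear_fun_scale (bact_linearr _)).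
  by rewrite !scalerA.
case: sc => v Dv ->; rewrite [bact _ _]bact_pi.
by apply: (bhat_eventually (n0 := 0%N)) => n _; exact: DA.
Qed.

Fact bact_continuous : continuous (fun p : bcompl hD * A => bact p.1 p.2).
Proof.
move=> [c0 a0] U /= Uca.
have := nbhsB (- bact c0 a0) Uca; rewrite addNr => /nbhs_bhat[e e0 eU].
have [d d0 Dd] := disc_absorbing (bhat_disc hD) c0.
have m0 : 0 < 1 + `|a0| by rewrite ltr_wpDr.
(* The difference splits into the action of [a] on [c - c0] and that of [a - a0] on [c0]. With [a]
   of norm at most 1 plus that of [a0], and [d *: c0] in [bhat], these constants put [2 * e] times
   each term into [bhat]. *)
pose s := 2 * e * (1 + `|a0|) / k; pose r := `|k * d| / (2 * e).
have s0 : s != 0 by rewrite mulf_neq0 ?invr_eq0// gt_eqF// !mulr_gt0.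
have r0 : 0 < r by rewrite divr_gt0 ?mulr_gt0 ?normr_gt0 ?mulf_neq0.
exists ([set c | bhat (s *: (c - c0))], [set a | `|a - a0| < 1 /\ `|a - a0| < r]).
  split.
    have := nbhsT c0 (nbhs0_scale s0 (bhat_nbhs hD)).
    by apply: filterS => _ [c cs <-] /=; rewrite addrC addKr.
  apply: filterI.
    by apply: filterS (nbhsx_ballx a0 1 ltr01) => a; rewrite -ball_normE /= distrC.
  by apply: filterS (nbhsx_ballx a0 r r0) => a; rewrite -ball_normE /= distrC.
move=> [c a] /= [cc0 [a1 ar]].
suff : bhat (e *: (bact c a - bact c0 a0)).
  by move/eU => [x Ux] /(congr1 (+%R (bact c0 a0))); rewrite addNKr [RHS]addrC subrK => <-.
rewrite -(subrK (bact c0 a) (bact c a)) -addrA scalerDr.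
rewrite -(linear_fun_sub (bact_linearl _)) -(linear_fun_sub (bact_linearr _)).
apply: (disc_half (bhat_disc hD)); rewrite scalerA.
  have := bact_bhat cc0 (a := a) (t := (1 + `|a0|)^-1).
  rewrite (_ : k * s * _ = 2 * e); last first.
    by rewrite /s (mulrC k) divfK// mulfK// gt_eqF.
  apply; rewrite normrZ normfV gtr0_norm// ler_pdivrMl// mulr1.
  by rewrite -(subrK a0 a) (le_trans (ler_normD _ _))// lerD2r ltW.
apply: (disc_le (bhat_disc hD) _ (bact_bhat Dd (t := r^-1) _)).
  rewrite (normrM (k * d)) (gtr0_norm (_ : 0 < r^-1)) ?invr_gt0// /r invf_div.
  by rewrite (mulrC `|k * d|) divfK ?normr_eq0 ?mulf_neq0// gtr0_norm ?mulr_gt0.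
by rewrite normrZ gtr0_norm ?invr_gt0// ler_pdivrMl// mulr1 ltW.
Qed.

Definition bact_action : right_action A (bcompl hD) :=
  RightAction bact_linearl bact_linearr bactA bact_continuous.

Definition bmod : rightBanachMod A := RightBanachMod bact_action.

End BanachModule.

(** * Tensor products with a completed module *)

Section TensAt.
Context (K : nzRingType) (Y X : lmodType K) (x : X).

Definition tens_at (y : Y) : tensor Y X := tens y x.

HB.instance Definition _ := GRing.isLinear.Build K Y (tensor Y X) *:%R
  tens_at (tens_linearl x).

End TensAt.

Section TensorCompletion.
Context (R : realType).
Local Notation C := R[i].
Context (A : banachAlgebra C) (Y X : tvsType C).
Context (rho : right_action A Y) (lam : left_action A X).
Context (D : set Y) (hD : disc D) (k : C) (k0 : k != 0).
Hypothesis DA : forall y (a : A), D y -> `|a| <= 1 -> D (k *: ract rho y a).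
Hypothesis D0 : nbhs 0 D.

Local Notation B := (bcompl hD).
Local Notation rhoB := (bact_action hD k0 DA).
Local Notation iota := (bcompl_inj hD : {linear Y -> B}).
Local Notation NA := (lspan (alg_balancing rho lam)).

Lemma bcompl_inj_continuous : continuous (bcompl_inj hD : Y -> B).
Proof.
apply: linear_continuous0 => U /nbhs_bhat[e e0 eU].
have e00 : e != 0 by rewrite gt_eqF.
apply: filterS (nbhs0_scale e00 D0) => y /= /(bhat_inj hD).
by have -> := linearZ_LR (bcompl_inj hD) e y; exact: eU.
Qed.

Lemma tensor_inj_cont : lc_cont (tensor_base rho lam) (tensor_base rhoB lam)
  (tensor_map X iota).
Proof.
apply: tensor_base_cont; first exact: bcompl_inj_continuous.
by move=> y a; rewrite /= [RHS]bact_inj.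
Qed.

(** In each elementary tensor the left factor is approximated by an element of [Y]; the error is one
    elementary tensor, small once [x] is scaled by [d] into [W0] and the left factor by [d^-1]. *)
Lemma tensor_dense (t : tensor B X) U : tensor_base rhoB lam U ->
  exists w, U (tensor_map X iota w - t).
Proof.
have [s ->] := tensor_sum t; elim: s U => [|[[l c] x] s IH] U bU.
  by exists 0; rewrite big_nil linear0 subr0; exact: lc_set0 bU.
have [Z bZ ZU] := lc_half bU; have [w Zw] := IH Z bZ.
have [S [U0 [W0 [U00 W00 ->]]] SZ] := lc_mod_coarser bZ.
have [d d0 Wd] := tvs_absorbing x W00.
have [e e0 eU] := nbhs_bhat U00.
have ed : e / d != 0 by rewrite mulf_neq0 ?invr_eq0// gt_eqF.
have [y hy] := bcompl_dense (l *: c) ed.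
have Uy : U0 (d^-1 *: (l *: c - bcompl_inj hD y)) by apply: eU; rewrite scalerA.
exists (tens y x + w); rewrite linearD big_cons opprD addrACA; apply: ZU => //.
rewrite -opprB; apply: (lc_opp bZ); apply: SZ.
exists [:: (1, d^-1 *: (l *: c - bcompl_inj hD y), d *: x)]; split.
- by move=> i; rewrite inE => /eqP ->.
- by rewrite big_seq1 normr1.
- rewrite big_seq1 scale1r /= tensZl tensZr scalerA mulVf// scale1r.
  rewrite -tensZl tensor_mapE.
  by rewrite (linear_fun_sub (tens_linearl x)).
Qed.

Let J (W : set X) : set (tensor Y X) :=
  [set t | exists2 m, m \in NA & proj_set D W (t - m)].

(** Passing to [B] makes the topology no coarser than the gauge of [J W]: [tens] extends to a
    bilinear map of [B] and [X] into the completion for that gauge. The induced [T] kills the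
    relations over [B], sends the hull of [bhat] and [W] into [bhat], and restricts to the canonical
    map on [tensor Y X]. The factor 2 is that of [bhat_injV]. *)
Lemma tensor_inj_reflects (W : set X) : nbhs 0 W ->
  exists2 U, tensor_base rhoB lam U &
    forall w, U (tensor_map X iota w) -> J W (2^-1 *: w).
Proof.
move=> W0.
have bD : proj_base Y X (proj_set D W) by exists D, W.
have hJ : disc (J W) by apply: (@lc_disc _ _ (tensor_base rho lam)); exists (proj_set D W).
have DW y x : D y -> W x -> J W (tens y x).
  move=> Dy Wx; exists 0; rewrite ?rpred0// subr0; exists [:: (1, y, x)]; split.
  - by move=> i; rewrite inE => /eqP ->.
  - by rewrite big_seq1 normr1.
  - by rewrite big_seq1 scale1r.
(* A scalar [e x] moving [x] into [W] bounds [tens_at x] from the gauge of [D] to that of [J W], so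
   that it extends to [B]. *)
have [e eP] := choice (fun x => let: ex_intro2 e e0 We := tvs_absorbing x W0 in
   ex_intro (fun e => e != 0 /\ W (e *: x)) e (conj e0 We)).
have tlD x y : D y -> J W (e x *: tens_at x y).
  by move=> Dy; rewrite -tensZr; apply: DW => //; exact: (eP x).2.
pose h (c : B) (x : X) : bcompl hJ := bmap hD hJ (eP x).1 (tlD x) c.
have h_pi u x : h (bcompl_pi u) x =
    bcompl_pi (cseq_map (disc_cont hD hJ (eP x).1 (tlD x)) u) by exact: bmap_pi.
have hl x : linear (h^~ x) by exact: bmap_linear.
have hr c : linear (h c).
  move=> a x x'; elim/bcompl_ind: c => u; rewrite !h_pi -linearP; congr bcompl_pi.
  by apply/val_inj/funext => n; exact: tens_linearr.
have [T TE] := tensor_lift hl hr.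
have Tinj w : T (tensor_map X iota w) = bcompl_inj hJ w.
  rewrite -[LHS]/((T \o tensor_map X iota) w).
  apply: tensor_linear_eq => y x /=; rewrite tensor_mapE TE; exact: bmap_inj.
have TN m : m \in lspan (alg_balancing rhoB lam) -> T m = 0.
  apply: lspan_eq0 => _ [c [a [x ->]]]; rewrite linearB /= !TE.
  (* Termwise, the image of a relation over [B] is a relation over [Y]; all multiples of it lie in
     [J W], so its gauge is 0. *)
  elim/bcompl_ind: c => u; rewrite [bact _ _ _ _]bact_pi !h_pi -linearB.
  rewrite -(linear0 (@bcompl_pi _ _ _ hJ)); apply/bcompl_eqP => _ [d d0 ->].
  exists 0%N => n _ /=; set z := (z in d *: z).
  have -> : z = tens (ract rho (u n) a) x - tens (u n) (lact lam a x) by exact: subr0.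
  set q := tens _ _ - _; exists (d *: q); first by rewrite rpredZ// lspan_gen//; exists (u n), a, x.
  by rewrite subrr; exact: lc_set0 bD.
have TJ t : proj_set (@bhat _ _ _ hD) W t -> bhat (T t).
  move=> [s [sU s1 ->]]; rewrite linear_sum.
  under eq_bigr do rewrite linearZ /= TE.
  apply: (disc_sum (bhat_disc hJ)) => // i /sU[[u Du ->] Wi].
  rewrite [h _ _]h_pi -[bcompl_pi _]scale1r; apply: (bhat_eventually (n0 := 0%N)) => n _.
  by rewrite scale1r; exact: DW.
exists [set t | exists2 m, m \in lspan (alg_balancing rhoB lam) &
    proj_set (@bhat _ _ _ hD) W (t - m)].
  exists (proj_set (@bhat _ _ _ hD) W) => //; exists (@bhat _ _ _ hD), W; split=> //.
  exact: bhat_nbhs.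
move=> w [m mN /TJ]; rewrite linearB /= Tinj (TN _ mN) subr0.
exact: bhat_injV.
Qed.

End TensorCompletion.

(** * Discs in Frechet modules *)

Lemma half_lt (K : numFieldType) (d : K) : 0 < d -> d / 2 < d.
Proof. by move=> d0; rewrite ltr_pdivrMr// ltr_pMr// ltr1n. Qed.

Section AbsolutelyConvex.
Context (K : numFieldType).

Definition absconvex (V : lmodType K) (D : set V) : Prop :=
  forall x y (a b : K), D x -> D y -> `|a| + `|b| <= 1 -> D (a *: x + b *: y).

Lemma absconvexI (V : lmodType K) (D E : set V) :
  absconvex D -> absconvex E -> absconvex (D `&` E).
Proof. by move=> cD cE x y a b [? ?] [? ?] ab; split; [exact: cD|exact: cE]. Qed.

Lemma absconvex_preim (V W : lmodType K) (f : {linear V -> W}) (D : set W) :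
  absconvex D -> absconvex (f @^-1` D).
Proof. by move=> cD x y a b Dx Dy ab; rewrite /preimage /= linearP linearZ; exact: cD. Qed.

Lemma nbhs_disc (E : tvsType K) (D : set E) : absconvex D -> nbhs 0 D -> disc D.
Proof. by move=> cD D0; split=> // x; exact: tvs_absorbing. Qed.

Lemma continuous0 (E F : tvsType K) (f : {linear E -> F}) U : continuous f ->
  nbhs 0 U -> nbhs 0 (f @^-1` U).
Proof. by move=> fc U0; apply: fc; rewrite linear0. Qed.

Lemma nbhs_balanced (E : tvsType K) (U : set E) : nbhs 0 U ->
  nbhs 0 [set x | forall l : K, `|l| <= 1 -> U (l *: x)].
Proof.
move=> U0; have := @scale_continuous K E (0, 0) U.
rewrite /= scale0r => /(_ U0) [[A B] /= [[d /= d0 dA] B0] AB].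
have d20 : d / 2 != 0 by rewrite gt_eqF// divr_gt0.
apply: filterS (nbhs0_scale (invr_neq0 d20) B0) => x /= Bx l l1.
rewrite -[l](mulfK d20) -scalerA; apply: (AB (_, _)); split=> //=.
apply: dA; rewrite /= sub0r normrN normrM (gtr0_norm (divr_gt0 d0 (ltr0Sn _ _))).
by apply: le_lt_trans (half_lt d0); rewrite ler_piMl// ltW// divr_gt0.
Qed.

(** Local convexity provides a convex [S]; the points whose multiples by scalars of modulus at most
    1 stay in [S] form a balanced set. Rotating the vectors turns scalar coefficients into their
    moduli, so that convexity of [S] applies. *)
Lemma absconvex_nbhs (E : tvsType K) (U : set E) : nbhs 0 U ->
  exists D, [/\ absconvex D, nbhs 0 D & D `<=` U].
Proof.
have [B Bconv [Bopen Bbase]] := @locally_convex K E.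
move=> /Bbase[S [BS S0] SU].
have cS : convex_set S by apply: Bconv; rewrite inE.
have S00 : nbhs 0 S by apply: open_nbhs_nbhs; split=> //; exact: Bopen.
pose D := [set x | forall l : K, `|l| <= 1 -> S (l *: x)].
have DS x : D x -> S x by move=> /(_ 1); rewrite normr1 scale1r; apply.
exists D; split; [|exact: nbhs_balanced|by move=> x /DS /SU].
have S0' : S 0 by exact: nbhs_singleton.
have Sconv x y (p : K) : S x -> S y -> 0 <= p -> p <= 1 -> S (p *: x + (1 - p) *: y).
  move=> Sx Sy p0 p1; have := cS x y (Itv01 p0 p1).
  by rewrite !inE; apply.
have phase (c : K) x : D x -> exists2 x', S x' & c *: x = `|c| *: x'.
  have [->|c0] := eqVneq c 0; first by exists 0; rewrite // normr0 !scale0r.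
  move=> Dx; exists ((c / `|c|) *: x).
    by apply: Dx; rewrite normrM normfV normr_id mulfV ?normr_eq0.
  by rewrite scalerA mulrC divfK ?normr_eq0.
move=> x y a b Dx Dy ab l l1; rewrite scalerDr !scalerA.
have [x' Sx' ->] := phase (l * a) x Dx; have [y' Sy' ->] := phase (l * b) y Dy.
pose s := `|l * a| + `|l * b|; have s_ge0 : 0 <= s by rewrite addr_ge0.
have s1 : s <= 1 by rewrite /s !normrM -mulrDr mulr_ile1// addr_ge0.
have [s0|s0] := eqVneq s 0.
  move: (s0) => /eqP; rewrite paddr_eq0// => /andP[/eqP -> /eqP ->].
  by rewrite !scale0r addr0.
have s_gt0 : 0 < s by rewrite lt0r s0.
(* A convex combination of [x'] and [y'] is shrunk towards 0 by the total weight [s]. *)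
have := Sconv _ _ s (Sconv _ _ (`|l * a| / s) Sx' Sy' _ _) S0' s_ge0 s1.
rewrite scaler0 addr0 scalerDr !scalerA mulrBr mulr1 (mulrC s) divfK//.
rewrite {3}/s addrAC subrr add0r; apply; first by rewrite divr_ge0.
by rewrite ler_pdivrMr// mul1r lerDl.
Qed.

Lemma frechet_discs (E : tvsType K) : frechet E ->
  exists D : nat -> set E, [/\ forall n, absconvex (D n), forall n, nbhs 0 (D n),
    forall n, D n.+1 `<=` D n &
    forall U, nbhs 0 U -> exists n0, forall n, (n0 <= n)%N -> D n `<=` U].
Proof.
move=> [_ [B [B0 BU]] _].
have [F FP] := choice (fun n => absconvex_nbhs (B0 n)).
pose D := fix D n := if n is n'.+1 then F n `&` D n' else F 0%N.
have DS n : D n.+1 `<=` D n by move=> x [].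
have FB n : F n `<=` B n by case: (FP n).
have DB n : D n `<=` B n by case: n => [|n] x; [|case=> + _]; exact: FB.
have Dle n m : (n <= m)%N -> D m `<=` D n.
  by move=> /subnKC <-; elim: (m - n)%N => [|k IH]; rewrite ?addn0// addnS => x /DS /IH.
exists D; split=> //.
- by elim=> [|n IH]; [case: (FP 0%N)|apply: absconvexI => //; case: (FP n.+1)].
- by elim=> [|n IH]; [case: (FP 0%N)|apply: filterI => //; case: (FP n.+1)].
- by move=> U /BU[n0 h]; exists n0 => n /Dle nn0 x /nn0 /DB /h.
Qed.

End AbsolutelyConvex.

(** * Neighbourhoods stable under the unit ball of [A] *)

Section Orbit.
Context (K : numFieldType) (A : banachAlgebra K) (Y : tvsType K) (rho : right_action A Y).

(** Since [A] may lack a unit, [unit_core D] need not lie in [D]; it is therefore intersected with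
    [D] to get a stable subset of [D]. *)
Definition unit_core (D : set Y) : set Y :=
  [set y | forall a : A, `|a| <= 1 -> D (ract rho y a)].

Lemma unit_core_absconvex D : absconvex D -> absconvex (unit_core D).
Proof.
move=> cD x y a b Dx Dy ab c c1.
rewrite (ract_linearl rho c) (linear_fun_scale (ract_linearl rho c)).
by apply: cD => //; [exact: Dx|exact: Dy].
Qed.

(** Joint continuity at the origin handles small [y] and [a] of norm less than [d]; a scalar moved
    from [y] to [a] reaches the whole unit ball. *)
Lemma unit_core_nbhs D : nbhs 0 D -> nbhs 0 (unit_core D).
Proof.
move=> D0; have := @ract_continuous _ _ _ rho (0, 0) D.
rewrite /= (_ : ract rho 0 0 = 0); last first.
  by have := linear_fun_scale (ract_linearl rho 0) 0 0; rewrite !scale0r.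
move=> /(_ D0) [[U V] /= [U0]]; rewrite -nbhs_ballE => -[d /= d0 dV] UV.
have d20 : d / 2 != 0 by rewrite gt_eqF// divr_gt0.
apply: filterS (nbhs0_scale (invr_neq0 d20) U0) => y /= Uy a a1.
rewrite -[y](scalerKV d20) (linear_fun_scale (ract_linearl rho a)).
rewrite -(linear_fun_scale (ract_linearr rho _)).
apply: (UV (_, _)); split=> //=; apply: dV.
rewrite -ball_normE /= sub0r normrN normrZ (gtr0_norm (divr_gt0 d0 (ltr0Sn _ _))).
by apply: le_lt_trans (half_lt d0); rewrite ler_piMr// ltW// divr_gt0.
Qed.

Lemma unit_core_act D y (a : A) : `|a| <= 1 -> (D `&` unit_core D) y ->
  (D `&` unit_core D) (ract rho y a).
Proof.
move=> a1 [_ Dy]; split; first exact: Dy.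
move=> b b1; rewrite ractA; apply: Dy; rewrite (le_trans (ba_mul_norm _ _))//.
by rewrite mulr_ile1.
Qed.

Lemma unit_coreS D E : D `<=` E -> unit_core D `<=` unit_core E.
Proof. by move=> DE y Dy a /Dy /DE. Qed.

End Orbit.

(** * Descent from a bounded disc *)

Section BoundedDisc.
Context (R : realType).
Local Notation C := R[i].
Context (A : banachAlgebra C) (X : leftBanachMod A).
Local Notation lam := (lbm_act X).

(* The gauge [q] of such a disc satisfies [q (y a) <= q y * |a| / |bd_factor|]. *)
Record bounded_disc (Y : tvsType C) (rho : right_action A Y) := BoundedDisc {
  bd_set :> set Y;
  bd_disc : disc bd_set;
  bd_nbhs : nbhs 0 bd_set;
  bd_factor : C;
  bd_factor0 : bd_factor != 0;
  bd_act : forall y (a : A), bd_set y -> `|a| <= 1 -> bd_set (bd_factor *: ract rho y a)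
}.

Definition bd_mod (Y : tvsType C) (rho : right_action A Y) (D : bounded_disc rho) :
  rightBanachMod A := bmod (bd_disc D) (bd_factor0 D) (@bd_act _ _ D).

Definition bd_inj (Y : tvsType C) (rho : right_action A Y) (D : bounded_disc rho) :
  {linear Y -> bd_mod D} := bcompl_inj (bd_disc D).

(** The topology coming from the completed module is pulled back to [tensor Y X], so that all discs
    give topologies on one space. *)
Definition bd_base (Y : tvsType C) (rho : right_action A Y) (D : bounded_disc rho) :
    lcBase (tensor Y X) :=
  lc_preim (tensor_map X (bd_inj D)) (tensor_base (rbm_act (bd_mod D)) lam).

Lemma bd_base_coarser (Y : tvsType C) (rho : right_action A Y) (D : bounded_disc rho) :
  lc_cont (tensor_base rho lam) (bd_base D) idfun.
Proof.
move=> _ [U bU ->].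
have h := @tensor_inj_cont _ _ _ _ rho lam D (bd_disc D) _ (bd_factor0 D)
  (@bd_act _ _ D) (bd_nbhs D).
exact: h bU.
Qed.

Lemma bd_dense (Y : tvsType C) (rho : right_action A Y) (D : bounded_disc rho) U t :
  tensor_base (rbm_act (bd_mod D)) lam U -> exists w, U (tensor_map X (bd_inj D) w - t).
Proof. exact: tensor_dense. Qed.

Section Maps.
Context (Y Z : tvsType C) (rho : right_action A Y) (sig : right_action A Z).
Context (D : bounded_disc rho) (E : bounded_disc sig) (f : {linear Y -> Z}).
Hypothesis fDE : forall y, bd_set D y -> bd_set E (f y).

Fact bd_map_subproof y : bd_set D y -> bd_set E (1 *: f y).
Proof. by move=> /fDE; rewrite scale1r. Qed.

Definition bd_map : {linear bd_mod D -> bd_mod E} :=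
  bmap (bd_disc D) (bd_disc E) (oner_neq0 _) bd_map_subproof.

Lemma bd_map_continuous : continuous bd_map.
Proof. exact: bmap_continuous. Qed.

Lemma bd_map_inj y : bd_map (bd_inj D y) = bd_inj E (f y).
Proof. exact: bmap_inj. Qed.

Lemma bd_map_tensor_inj t :
  tensor_map X bd_map (tensor_map X (bd_inj D) t) = tensor_map X (bd_inj E) (tensor_map X f t).
Proof.
rewrite -[LHS]/((tensor_map X bd_map \o tensor_map X (bd_inj D)) t).
rewrite -[RHS]/((tensor_map X (bd_inj E) \o tensor_map X f) t).
by apply: tensor_linear_eq => y x /=; rewrite !tensor_mapE bd_map_inj.
Qed.

Hypothesis f_act : forall y a, f (ract rho y a) = ract sig (f y) a.

Lemma bd_map_act c a :
  bd_map (ract (rbm_act (bd_mod D)) c a) = ract (rbm_act (bd_mod E)) (bd_map c) a.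
Proof.
elim/bcompl_ind: c => u; rewrite /= [bact _ _ _ _]bact_pi /bd_map /= !bmap_pi [RHS]bact_pi.
by congr bcompl_pi; apply/val_inj/funext => n /=; exact: f_act.
Qed.

Definition bd_hom : rmod_hom (right_frechet_of_banach (bd_mod D))
    (right_frechet_of_banach (bd_mod E)) :=
  @RModHom _ _ (right_frechet_of_banach (bd_mod D)) (right_frechet_of_banach (bd_mod E))
    bd_map bd_map_continuous bd_map_act.

Lemma bd_base_cont : lc_cont (bd_base D) (bd_base E) (tensor_map X f).
Proof.
move=> _ [U bU ->].
have [Z0 bZ ZU] := tensor_base_cont bd_map_continuous bd_map_act bU.
exists (tensor_map X (bd_inj D) @^-1` Z0); first by exists Z0.
by move=> t /ZU; rewrite /preimage /= -bd_map_tensor_inj.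
Qed.

End Maps.

Definition alg_hull (Y : tvsType C) (rho : right_action A Y) (D : set Y) (W : set X) :
    set (tensor Y X) :=
  [set t | exists2 m, m \in lspan (alg_balancing rho lam) & proj_set D W (t - m)].

Lemma bd_base_reflects (Y : tvsType C) (rho : right_action A Y) (D : bounded_disc rho)
    (W : set X) : nbhs 0 W ->
  exists U, bd_base D U /\ forall w, U w -> alg_hull rho D W (2^-1 *: w).
Proof.
move=> W0; have [U bU UP] := @tensor_inj_reflects _ _ _ _ rho lam D (bd_disc D) _
  (bd_factor0 D) (@bd_act _ _ D) (bd_nbhs D) W W0.
by exists (tensor_map X (bd_inj D) @^-1` U); split; [exists U|].
Qed.

(** The factor 2 lost in [bd_base_reflects] is absorbed by shrinking [S] beforehand. *)
Lemma alg_hull_sub (Y : tvsType C) (rho : right_action A Y) S : tensor_base rho lam S ->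
  exists U W, [/\ nbhs 0 U, nbhs 0 W & forall D E, D `<=` U -> E `<=` W ->
    forall w, alg_hull rho D E (2^-1 *: w) -> S w].
Proof.
move=> /(lc_homothety 2)[_ [_ [U [W [U0 W0 ->]]] ->] TS].
exists U, W; split=> // D E DU EW w [m mN [s [sD s1 ws]]].
rewrite -[w](@scalerKV _ _ 2) ?pnatr_eq0//; apply: TS; exists m => //.
exists s; split=> // i /sD[? ?]; by split; [exact: DU|exact: EW].
Qed.

Section Core.
Context (Y : tvsType C) (rho : right_action A Y) (D : set Y).
Hypotheses (cD : absconvex D) (D0 : nbhs 0 D).

Let core_nbhs : nbhs 0 (D `&` unit_core rho D).
Proof. by apply: filterI => //; exact: unit_core_nbhs. Qed.

Let core_disc : disc (D `&` unit_core rho D).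
Proof. by apply: nbhs_disc => //; apply: absconvexI => //; exact: unit_core_absconvex. Qed.

Let core_act y (a : A) : (D `&` unit_core rho D) y -> `|a| <= 1 ->
  (D `&` unit_core rho D) (1 *: ract rho y a).
Proof. by move=> Dy a1; rewrite scale1r; exact: unit_core_act. Qed.

Definition bd_core : bounded_disc rho :=
  BoundedDisc core_disc core_nbhs (oner_neq0 _) core_act.

Lemma bd_core_act y (a : A) : bd_set bd_core y -> `|a| <= 1 -> bd_set bd_core (ract rho y a).
Proof. by move=> Dy a1; exact: unit_core_act. Qed.

End Core.

End BoundedDisc.

(** * Banach flatness applied to the completions for three compatible discs *)

Section Descent.
Context (R : realType).
Local Notation C := R[i].
Context (A : banachAlgebra C) (X : leftBanachMod A).
Context (Y1 Y2 Y3 : rightFrechetMod A) (f : rmod_hom Y1 Y2) (g : rmod_hom Y2 Y3).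
Context (r : {linear Y2 -> Y1}) (s : {linear Y3 -> Y2}).
Hypothesis rf : forall y, r (f y) = y.
Hypothesis gs : forall y, g (s y) = y.
Hypothesis rs : forall y, r (s y) = 0.
Hypothesis gf : forall y, g (f y) = 0.
Hypothesis fr_sg : forall y, f (r y) + s (g y) = y.
Context (Q : bounded_disc (rfm_act Y1)) (M : bounded_disc (rfm_act Y2))
  (P : bounded_disc (rfm_act Y3)).
Hypothesis MQP : forall y, bd_set M y <-> bd_set Q (r y) /\ bd_set P (g y).
Hypothesis XB : banach_flat X.

(** By [MQP] all of [f], [g], [r], [s] are bounded for the gauges, so they extend to the completions
    and the identities of the splitting persist. Flatness gives a solution in the tensor product
    with the completed module, which density brings back to [tensor Y1 X]. *)
Lemma bd_seq_exact : seq_exact (tensor_map X f) (tensor_map X g)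
  (bd_base X Q) (bd_base X M) (bd_base X P).
Proof.
have P0 : bd_set P 0 by exact: nbhs_singleton (bd_nbhs P).
have Q0 : bd_set Q 0 by exact: nbhs_singleton (bd_nbhs Q).
have fQ y : bd_set Q y -> bd_set M (f y) by move=> Qy; apply/MQP; rewrite rf gf.
have gM y : bd_set M y -> bd_set P (g y) by move=> /MQP[].
have rM y : bd_set M y -> bd_set Q (r y) by move=> /MQP[].
have sP y : bd_set P y -> bd_set M (s y) by move=> Py; apply/MQP; rewrite rs gs.
pose F := bd_hom fQ (@rhom_act _ _ _ _ f).
pose G := bd_hom gM (@rhom_act _ _ _ _ g).
have RF c : bd_map rM (bd_map fQ c) = c.
  elim/bcompl_ind: c => u; rewrite /bd_map /= !bmap_pi.
  by congr bcompl_pi; apply/val_inj/funext => n /=; exact: rf.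
have GS c : bd_map gM (bd_map sP c) = c.
  elim/bcompl_ind: c => u; rewrite /bd_map /= !bmap_pi.
  by congr bcompl_pi; apply/val_inj/funext => n /=; exact: gs.
have GF c : bd_map gM (bd_map fQ c) = 0.
  elim/bcompl_ind: c => u; rewrite /bd_map /= !bmap_pi -(linear0 (@bcompl_pi _ _ _ _)).
  by congr bcompl_pi; apply/val_inj/funext => n /=; exact: gf.
have FRSG c : bd_map fQ (bd_map rM c) + bd_map sP (bd_map gM c) = c.
  elim/bcompl_ind: c => u; rewrite /bd_map /= !bmap_pi -linearD.
  by congr bcompl_pi; apply/val_inj/funext => n /=; exact: fr_sg.
have FGex : short_exact F G.
  split=> [c d|c|c].
  - by move=> /(congr1 (bd_map rM)); rewrite /= !RF.
  - split=> [gc0|[d <-]]; last exact: GF.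
    exists (bd_map rM c); rewrite -[RHS]FRSG /=.
    by rewrite [bd_map gM c]gc0 linear0 addr0.
  - by exists (bd_map sP c); exact: GS.
have FGsplit : topologically_split F G.
  by exists (bd_map rM), (bd_map sP); split=> //; exact: bd_map_continuous.
have [inj mid] := short_exact_seq (XB FGex FGsplit).
have Fcont := @rmod_hom_tensor_cont _ _ (left_frechet_of_banach X) _ _ F.
split=> [u /lc_preim_cauchy cu /lc_preim_null fu|u /lc_preim_cauchy cu /lc_preim_null gu].
  apply/lc_preim_null; apply: inj => //; apply: lc_null_ext fu => n /=.
  by rewrite bd_map_tensor_inj.
have [|w cw wu] := mid _ cu.
  by apply: lc_null_ext gu => n /=; rewrite bd_map_tensor_inj.
(* With a countable base, approximating the term [w n] within [S n] changes [w] by a null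
   sequence. *)
have [S bS SU] := lc_mod_countable (lspan (alg_balancing (rbm_act (bd_mod Q)) (lbm_act X)))
  (proj_base_countable (right_frechet_of_banach (bd_mod Q)) (left_frechet_of_banach X)).
have dense n : exists v, S n (tensor_map X (bd_inj Q) v - w n).
  exact: bd_dense (bS n).
have [v vS] := choice dense.
have vw : lc_null (tensor_base (rbm_act (bd_mod Q)) (lbm_act X))
    (fun n => tensor_map X (bd_inj Q) (v n) - w n).
  by move=> U /SU[n0 SnU]; exists n0 => n /SnU; apply; exact: vS.
exists v; first by apply/lc_preim_cauchy; exact: lc_cauchy_null cw vw.
apply/lc_preim_null; apply: lc_null_ext (lc_nullD (lc_cont_null Fcont vw) wu) => n /=.
by rewrite !linearB /= bd_map_tensor_inj addrA subrK.
Qed.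

End Descent.

Lemma bd_base_sub (R : realType) (A : banachAlgebra R[i]) (X : leftBanachMod A)
    (Y : tvsType R[i]) (rho : right_action A Y) (D E : bounded_disc rho) :
  bd_set D `<=` bd_set E -> lc_cont (bd_base X D) (bd_base X E) idfun.
Proof.
move=> DE; have := @bd_base_cont _ _ X _ _ _ _ D E idfun DE (fun _ _ => erefl).
congr lc_cont; apply/funext => t; rewrite -[RHS]/((idfun : {linear _ -> _}) t).
by apply: tensor_linear_eq => y x /=; rewrite tensor_mapE.
Qed.

(** * The Frechet case as a limit of Banach cases *)

Section FrechetFlat.
Context (R : realType).
Local Notation C := R[i].
Context (A : banachAlgebra C) (X : leftBanachMod A).
Context (Y1 Y2 Y3 : rightFrechetMod A) (f : rmod_hom Y1 Y2) (g : rmod_hom Y2 Y3).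
Local Notation c Y := (tensor_base (rfm_act Y) (lbm_act X)).

Lemma banach_flat_seq_exact : banach_flat X -> short_exact f g ->
  topologically_split f g ->
  seq_exact (tensor_map X f) (tensor_map X g) (c Y1) (c Y2) (c Y3).
Proof.
move=> XB [_ fg0 _] [r [s [rc sc rf gs frsg]]].
have gf y : g (f y) = 0 by apply/fg0; exists y.
have rs y : r (s y) = 0.
  have /eqP := frsg (s y); rewrite gs -subr_eq0 addrK => /eqP fr0.
  by rewrite -[LHS]rf fr0 linear0.
have fc := @rhom_continuous _ _ _ _ f; have gc := @rhom_continuous _ _ _ _ g.
have [D1 [cD1 nD1 D1S D1B]] := frechet_discs (rfm_frechet Y1).
have [D3 [cD3 nD3 D3S D3B]] := frechet_discs (rfm_frechet Y3).
have [DX [_ nDX _ DXB]] := frechet_discs (lfm_frechet (left_frechet_of_banach X)).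
pose Q n : bounded_disc (rfm_act Y1) := bd_core (rfm_act Y1) (@cD1 n) (nD1 n).
have cQ n : absconvex (bd_set (Q n)) by exact: disc_absconvex (bd_disc (Q n)).
(* The map [r] need not respect the action: [r (y a)] is [(r y) a] plus the defect [r (s (g y) a)].
   The set [E n] forces the defect into [Q n] when [g y] is in [E n] and [a] in the unit ball. *)
pose E n := D3 n `&` s @^-1` (unit_core (rfm_act Y2) (r @^-1` (bd_set (Q n)))).
have cE n : absconvex (E n).
  apply: absconvexI => //; apply: absconvex_preim; apply: unit_core_absconvex.
  exact: absconvex_preim.
have nE n : nbhs 0 (E n).
  apply: filterI => //; apply: continuous0 => //; apply: unit_core_nbhs.
  by apply: continuous0 => //; exact: bd_nbhs.
pose P n : bounded_disc (rfm_act Y3) := bd_core (rfm_act Y3) (@cE n) (nE n).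
have cP n : absconvex (bd_set (P n)) by exact: disc_absconvex (bd_disc (P n)).
pose M0 n := (r @^-1` bd_set (Q n)) `&` (g @^-1` bd_set (P n)).
have nM n : nbhs 0 (M0 n) by apply: filterI; apply: continuous0 => //; exact: bd_nbhs.
have cM n : absconvex (M0 n) by apply: absconvexI; exact: absconvex_preim.
have dM n : disc (M0 n) by exact: nbhs_disc.
have half0 : (2^-1 : C) != 0 by rewrite invr_eq0 pnatr_eq0.
(* The factor 1/2 appears because [r (y a)] is a sum of two elements of [Q n]. *)
have MA n y (a : A) : M0 n y -> `|a| <= 1 -> M0 n (2^-1 *: ract (rfm_act Y2) y a).
  move=> [Qy Py] a1.
  have Qf : bd_set (Q n) (ract (rfm_act Y1) (r y) a).
    exact: bd_core_act Qy a1.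
  have Pg : bd_set (P n) (ract (rfm_act Y3) (g y) a).
    exact: bd_core_act Py a1.
  have Qs : bd_set (Q n) (r (ract (rfm_act Y2) (s (g y)) a)).
    by have [[_ h] _] := Py; exact: h.
  split; rewrite /preimage /=.
    rewrite -(frsg y) (linear_fun_add (ract_linearl (rfm_act Y2) a)) -rhom_act.
    rewrite linearZ_LR linearD /= rf scalerDr.
    apply: (disc_absconvex (bd_disc (Q n))) => //.
    by rewrite normfV normr_nat [leRHS]splitr mul1r.
  rewrite linearZ_LR /= rhom_act; apply: (disc_balanced (bd_disc (P n))) => //.
  by rewrite normfV normr_nat invf_le1 ?ler1n.
pose M n : bounded_disc (rfm_act Y2) := BoundedDisc (dM n) (nM n) half0 (@MA n).
have QS n : bd_set (Q n.+1) `<=` bd_set (Q n).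
  by move=> y [/D1S Dy /(unit_coreS (@D1S n)) Uy].
have ES n : E n.+1 `<=` E n.
  move=> y [/D3S Dy h]; split=> // a a1; apply: QS; exact: h.
have PS n : bd_set (P n.+1) `<=` bd_set (P n).
  by move=> y [/ES Dy /(unit_coreS (@ES n)) Uy].
have MS n : bd_set (M n.+1) `<=` bd_set (M n) by move=> y [/QS ? /PS ?].
have [U UP] := choice (fun n => bd_base_reflects (X := X) (Q n) (nDX n)).
apply: (@seq_exact_limit _ _ _ _ _ _ _ _ _ (fun n => bd_base X (Q n))
  (fun n => bd_base X (M n)) (fun n => bd_base X (P n)) _ _ _ _ _ _ U)
  => [n|n|n|n|n|n|n|W cW|W cW|n].
- exact: bd_base_coarser.
- exact: bd_base_coarser.
- exact: bd_base_coarser.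
- exact: bd_base_sub.
- exact: bd_base_sub.
- apply: bd_base_cont; last exact: rhom_act.
  by move=> y Qy; split; rewrite /preimage /= ?rf// gf; exact: (nbhs_singleton (bd_nbhs (P n))).
- by have [] := UP n.
- have [S [T [S0 T0 STW]]] := alg_hull_sub cW.
  have [n0 DS] := D1B S S0; have [n1 DT] := DXB T T0.
  exists (maxn n0 n1) => n; rewrite geq_max => /andP[n0n n1n] t /(UP n).2.
  apply: STW; last exact: DT.
  by move=> y [/(DS _ n0n)].
(* The discs [M n] shrink to 0 in [Y2]: [y] is [f (r y) + s (g y)], and both terms are small when
   [r y] is in [D1 n] and [g y] in [D3 n] for a large [n]. *)
- have [S [T [S0 T0 STW]]] := alg_hull_sub cW.
  have two0 : (2 : C) != 0 by rewrite pnatr_eq0.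
  have [S' [cS' S'0 S'S]] := absconvex_nbhs S0.
  have S'20 := nbhs0_scale two0 S'0.
  have [n1 D1S'] := D1B _ (continuous0 fc S'20).
  have [n3 D3S'] := D3B _ (continuous0 sc S'20).
  pose n := maxn n1 n3; have [Z [MZ ZT]] := bd_base_reflects (M n) T0.
  exists n, Z => // t /ZT; apply: STW => // y [[Qy _] [[Py _] _]].
  rewrite -(frsg y); apply: S'S; apply: (disc_half (nbhs_disc cS' S'0)).
    exact: D1S' (leq_maxl _ _) _ Qy.
  exact: D3S' (leq_maxr _ _) _ Py.
- by apply: bd_seq_exact => // y.
Qed.

End FrechetFlat.

Unset Implicit Arguments.

Theorem proposition4p3 (R : realType) (A : banachAlgebra R[i])
    (X : leftBanachMod A) :
  frechet_flat (left_frechet_of_banach X) <-> banach_flat X.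
Proof.
(* Banach modules enter [banach_flat] as Frechet modules, so the direct implication is a
   specialization. *)
split=> [XF Y1 Y2 Y3 f g|XB Y1 Y2 Y3 f g fg_exact fg_split]; first exact: XF.
apply: seq_short_exact => //; exact: banach_flat_seq_exact.
Qed.
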